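(* Let $r\ge 1$, $G=(SU(2))^r$, and identify the set $S$ of simple reflections with $\{1,\ldots,r\}$. For every simplicial complex $\mathcal K\subseteq2^S$ there is a natural homotopy equivalence $$X_{\mathcal K}((SU(2))^r)\simeq(D^3,S^2)^{\mathcal K}.$$
   Context: A simplicial complex $\mathcal K\subseteq2^S$ is a family of subsets of $S$ containing $\varnothing$ and closed under subsets (elements of $S$ need not be vertices). For a compact, connected, simply connected semisimple $G$ with maximal torus $T$ and simple reflections $S$, and $I\subseteq S$, $G_I$ is the connected maximal-rank subgroup generated by $T$ and the rank-one root subgroups indexed by $I$, and $X_{\mathcal K}(G)=\operatorname{hocolim}_{I\in\mathcal K}G/G_I$ is the Bousfield--Kan homotopy colimit of the canonical projections $G/G_I\to G/G_J$ ($I\subseteq J$) over the poset of faces of $\mathcal K$ (including $\varnothing$). For $G=(SU(2))^r$ one has $G/G_I\cong\prod_{j\notin I}S^2$, and the map for $I\subseteq J$ is the projection forgetting the factors indexed by $J\setminus I$. The polyhedral product is $(D^3,S^2)^{\mathcal K}=\bigcup_{I\in\mathcal K}\bigl(\prod_{j\in I}D^3\times\prod_{j\notin I}S^2\bigr)\subseteq(D^3)^r$, with $S^2=\partial D^3$. *)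

(* Defs.v *)
From HB Require Import structures.
From Stdlib Require Import Relation_Operators.
From mathcomp Require Import all_boot all_order all_algebra.
From mathcomp Require Import complex generic_quotient spectral.
From mathcomp Require Import all_classical all_reals topology normedtype.
From mathcomp Require Import unstable.
Import Order.TTheory GRing.Theory Num.Theory numFieldNormedType.Exports.

Set Implicit Arguments.
Unset Strict Implicit.
Unset Printing Implicit Defensive.

Local Open Scope classical_set_scope.
Local Open Scope ring_scope.
Local Open Scope quotient_scope.

Section HomotopyEquivalence.
Context (R : realType) (X Y : topologicalType).

Definition unit_interval : set R := `[0, 1].

Definition homotopic (Z W : topologicalType) (f g : Z -> W) :=
  exists H : Z * unit_interval -> W, continuous H /\
    forall z (t : unit_interval),
      (\val t = 0 -> H (z, t) = f z) /\ (\val t = 1 -> H (z, t) = g z).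

Definition homotopy_equivalence (f : X -> Y) :=
  continuous f /\ exists g : Y -> X,
    [/\ continuous g, homotopic (g \o f) id & homotopic (f \o g) id].

End HomotopyEquivalence.

(* Diagrams of spaces over a type [P] preordered by [le] *)
Record diagram (P : Type) (le : rel P) := Diagram {
  dobj :> P -> topologicalType;
  dmap : forall i j, le i j -> dobj i -> dobj j;
  dmap_cts : forall i j (h : le i j), continuous (dmap h);
  dmap_id : forall i (h : le i i) x, dmap h x = x;
  dmap_comp : forall i j k (hij : le i j) (hjk : le j k) (hik : le i k) x,
    dmap hjk (dmap hij x) = dmap hik x }.

Arguments dmap {P le} d {i j} h.

(* [n]-simplices of the nerve of [P], degenerate ones included *)
Record chain (P : Type) (le : rel P) (n : nat) := Chain {
  vertex :> 'I_n.+1 -> P;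
  chain_le : forall a b : 'I_n.+1, (a <= b)%N -> le (vertex a) (vertex b) }.

HB.instance Definition _ P le n := gen_eqMixin (@chain P le n).
HB.instance Definition _ P le n := gen_choiceMixin (@chain P le n).

Lemma chain_le0 P le n (c : @chain P le n) b : le (c ord0) (c b).
Proof. exact: chain_le. Qed.

Definition monotone m n (th : 'I_m.+1 -> 'I_n.+1) :=
  forall a b : 'I_m.+1, (a <= b)%N -> (th a <= th b)%N.

Definition chain_pull P (le : rel P) m n (th : 'I_m.+1 -> 'I_n.+1)
    (hth : monotone th) (c : chain le n) : chain le m :=
  Chain (fun a b hab => chain_le c (hth a b hab)).

Section StandardSimplex.
Context (R : realType).

Definition simplex n : set 'rV[R]_n.+1 :=
  [set t | (forall a, 0 <= t 0 a) /\ \sum_a t 0 a = 1].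
Arguments simplex : clear implicits.

(* the affine map of standard simplices induced by [th] on vertices *)
Definition push_coord m n (th : 'I_m.+1 -> 'I_n.+1) (t : 'rV[R]_m.+1) :
    'rV[R]_n.+1 := \row_b \sum_(a | th a == b) t 0 a.

Lemma push_coord_simplex m n (th : 'I_m.+1 -> 'I_n.+1) (t : simplex m) :
  push_coord th (\val t) \in simplex n.
Proof.
have [t0 t1] := set_mem (valP t); apply/mem_set; split=> [b|].
  by rewrite mxE; apply: sumr_ge0.
under eq_bigr do rewrite mxE.
by rewrite -t1 [RHS](partition_big th xpredT).
Qed.

Definition simplex_push m n (th : 'I_m.+1 -> 'I_n.+1) (t : simplex m) :
    simplex n := exist _ (push_coord th (\val t)) (push_coord_simplex th t).

End StandardSimplex.
Arguments simplex : clear implicits.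

Section Hocolim.
Context (R : realType).

(* The Bousfield-Kan homotopy colimit is the geometric realization of the
   simplicial replacement [n |-> \coprod_(c_0 <= ... <= c_n) D c_0], whose
   structure map along [th : [m] -> [n]] sends the summand of [c] to that of
   [c \o th] by [D (c_0 <= c_(th 0))]. *)
Definition bk_total P (le : rel P) (D : diagram le) : Type :=
  {s : {n : nat & chain le n} &
    (D (projT2 s ord0) * simplex R (projT1 s))%type}.

HB.instance Definition _ P le D := Topological.on (@bk_total P le D).

Section OneDiagram.
Context (P : Type) (le : rel P) (D : diagram le).

Definition bk_point n (c : chain le n) (x : D (c ord0)) (t : simplex R n) :
    bk_total D :=
  existT (fun s : {n : nat & chain le n} =>
            (D (projT2 s ord0) * simplex R (projT1 s))%type)
         (existT (chain le) n c) (x, t).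

Inductive bk_glue : bk_total D -> bk_total D -> Prop :=
  BkGlue m n (th : 'I_m.+1 -> 'I_n.+1) (hth : monotone th) (c : chain le n)
      (x : D (c ord0)) (t : simplex R m) :
    bk_glue (bk_point x (simplex_push th t))
            (@bk_point _ (chain_pull hth c)
              (dmap D (chain_le0 c (th ord0)) x) t).

Definition bk_rel (a b : bk_total D) : bool :=
  `[< clos_refl_sym_trans _ bk_glue a b >].

Lemma bk_rel_refl : reflexive bk_rel.
Proof. by move=> a; apply/asboolP; exact: rst_refl. Qed.

Lemma bk_rel_sym : symmetric bk_rel.
Proof. by move=> a b; apply/asboolP/asboolP; exact: rst_sym. Qed.

Lemma bk_rel_trans : transitive bk_rel.
Proof.
by move=> b a c /asboolP ab /asboolP bc; apply/asboolP; exact: rst_trans bc.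
Qed.

Definition bk_equiv : equiv_rel (bk_total D) :=
  EquivRel bk_rel bk_rel_refl bk_rel_sym bk_rel_trans.

Definition hocolim : topologicalType :=
  quotient_topology {eq_quot bk_equiv}.

Definition hocolim_pi (a : bk_total D) : hocolim :=
  \pi_(quotient_topology {eq_quot bk_equiv}) a.

Definition hocolim_repr (q : hocolim) : bk_total D :=
  repr (q : quotient_topology {eq_quot bk_equiv}).

Lemma hocolim_reprK q : hocolim_pi (hocolim_repr q) = q.
Proof. exact: reprK. Qed.

Lemma hocolim_piP a b :
  clos_refl_sym_trans _ bk_glue a b <-> hocolim_pi a = hocolim_pi b.
Proof.
split=> [ab|/eqmodP /asboolP //].
by apply/eqmodP; exact/asboolP.
Qed.

End OneDiagram.

(* Functoriality in the indexing preorder and the diagram *)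
Section Functoriality.
Context (P P' : Type) (le : rel P) (le' : rel P').
Context (D : diagram le) (D' : diagram le').
Context (phi : P -> P') (hphi : forall i j, le i j -> le' (phi i) (phi j)).
Context (alpha : forall i, D i -> D' (phi i)).

Definition chain_push n (c : chain le n) : chain le' n :=
  Chain (fun a b hab => hphi (chain_le c hab)).

Definition bk_push (a : bk_total D) : bk_total D' :=
  let: existT (existT n c) (x, t) := a in
  @bk_point _ _ D' n (chain_push c) (alpha x) t.

Definition hocolim_map (q : hocolim D) : hocolim D' :=
  hocolim_pi (bk_push (hocolim_repr q)).

Hypothesis alpha_natural : forall i j (h : le i j) x,
  alpha (dmap D h x) = dmap D' (hphi h) (alpha x).

Lemma hocolim_map_pi a : hocolim_map (hocolim_pi a) = hocolim_pi (bk_push a).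
Proof.
suff H x y : clos_refl_sym_trans _ (@bk_glue _ _ D) x y ->
    hocolim_pi (bk_push x) = hocolim_pi (bk_push y).
  exact/H/hocolim_piP/hocolim_reprK.
elim=> {x y a} [_ _ [m n th hth c x t]|//|x y _ ->//|x y z _ -> _ ->//].
apply/hocolim_piP; apply: rst_step; rewrite /= alpha_natural.
rewrite (Prop_irrelevance (hphi _) (chain_le0 (chain_push c) (th ord0))).
exact: (@BkGlue _ _ D' m n th hth (chain_push c)).
Qed.

Hypothesis alpha_cts : forall i, continuous (@alpha i).

Lemma hocolim_map_continuous : continuous hocolim_map.
Proof.
apply/quotient_continuous.
have -> : hocolim_map \o \pi_(quotient_topology {eq_quot bk_equiv D}) =
    @hocolim_pi _ _ D' \o bk_push by apply/funext => a; exact: hocolim_map_pi.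
have push_cts : continuous (bk_push : bk_total D -> bk_total D').
  pose f (s : {n : nat & chain le n})
      (z : (D (projT2 s ord0) * simplex R (projT1 s))%type) : bk_total D' :=
    @bk_point _ _ D' _ (chain_push (projT2 s)) (alpha z.1) z.2.
  have -> : bk_push = sigT_fun f by apply/funext => -[[n c] [x t]].
  apply: sigT_continuous => -[n c] z.
  apply: (@continuous_comp _ _ _
    (fun z : (D (c ord0) * simplex R n)%type => (alpha z.1, z.2))
    (existT (fun s : {n : nat & chain le' n} =>
       (D' (projT2 s ord0) * simplex R (projT1 s))%type)
       (existT (chain le') n (chain_push c)))); last exact: existT_continuous.
  have H : alpha w.1 @[w --> z] --> alpha z.1.
    by apply: continuous_comp; [exact: cvg_fst|exact: alpha_cts].
  exact: (cvg_pair H cvg_snd).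
by move=> a; apply: continuous_comp; [exact: push_cts|exact: pi_continuous].
Qed.

End Functoriality.
End Hocolim.

HB.instance Definition _ (R : realType) := PseudoMetric.copy R[i] (R[i])^o.

Section SU2.
Context (R : realType).

Definition SU2_set : set 'M[R[i]]_2 :=
  [set U | U \is unitarymx /\ \det U = 1].

Definition SU2 : Type := SU2_set.

HB.instance Definition _ := Topological.copy SU2 SU2_set.

Lemma SU2_1 : 1%:M \in SU2_set.
Proof.
apply/mem_set; split; last exact: det1.
by apply/unitarymxP; rewrite trmx1 map_mx1 mulmx1.
Qed.

Lemma SU2_mul (U V : SU2) : \val U *m \val V \in SU2_set.
Proof.
have [[uU dU] [uV dV]] := (set_mem (valP U), set_mem (valP V)).
apply/mem_set; split; first exact: mul_unitarymx.
by rewrite det_mulmx dU dV mulr1.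
Qed.

Lemma SU2_inv (U : SU2) : invmx (\val U) \in SU2_set.
Proof.
have [uU dU] := set_mem (valP U).
apply/mem_set; split; last by rewrite det_inv dU invr1.
by rewrite (invmx_unitary uU) (trmxC_unitary (\val U)).
Qed.

Lemma SU2_unit (U : SU2) : \val U \in unitmx.
Proof. by have [/unitarymx_unit] := set_mem (valP U). Qed.

Definition SU2_one : SU2 := exist _ 1%:M SU2_1.
Definition SU2_mulg (U V : SU2) : SU2 := exist _ (\val U *m \val V) (SU2_mul U V).
Definition SU2_invg (U : SU2) : SU2 := exist _ (invmx (\val U)) (SU2_inv U).

Lemma SU2_mulgA : associative SU2_mulg.
Proof. by move=> U V W; apply: val_inj; exact: mulmxA. Qed.
Lemma SU2_mul1g : left_id SU2_one SU2_mulg.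
Proof. by move=> U; apply: val_inj; exact: mul1mx. Qed.
Lemma SU2_mulg1 : right_id SU2_one SU2_mulg.
Proof. by move=> U; apply: val_inj; exact: mulmx1. Qed.
Lemma SU2_mulVg : left_inverse SU2_one SU2_invg SU2_mulg.
Proof. by move=> U; apply: val_inj; exact/mulVmx/SU2_unit. Qed.
Lemma SU2_mulgV : right_inverse SU2_one SU2_invg SU2_mulg.
Proof. by move=> U; apply: val_inj; exact/mulmxV/SU2_unit. Qed.

HB.instance Definition _ := isGroup.Build SU2
  SU2_mulgA SU2_mul1g SU2_mulg1 SU2_mulVg SU2_mulgV.

End SU2.

(* the product topology on [{ffun I -> T}] *)
HB.instance Definition _ (I : finType) (T : topologicalType) :=
  Topological.copy {ffun I -> T}
    (initial_topology
      (fun f : {ffun I -> T} => (f : prod_topology (fun=> T)))).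

Section Subgroups.
Context (R : realType) (r : nat).

(* (SU(2))^r, with the pointwise group structure of [{ffun _ -> _}] *)
Definition SU2pow : Type := {ffun 'I_r -> SU2 R}.
HB.instance Definition _ := Group.on SU2pow.
HB.instance Definition _ := Topological.on SU2pow.

Implicit Types (H T : set SU2pow) (I J : {set 'I_r}).

Definition is_subgroup H :=
  [/\ H 1%g, forall x y, H x -> H y -> H (x * y)%g & forall x, H x -> H x^-1%g].

Lemma is_subgroup_smallest (A : set SU2pow) :
  is_subgroup (smallest is_subgroup A).
Proof.
split=> [B [[B1 _ _] _] //|x y Ax Ay B [sB AB]|x Ax B [sB AB]].
  by case: (sB) => _ BM _; apply: BM; [exact: Ax|exact: Ay].
by case: (sB) => _ _; apply; exact: Ax.
Qed.

(* A compact connected abelian subgroup of a compact Lie group is a torus. *)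
Definition is_torus T :=
  [/\ is_subgroup T, compact T, connected T
    & forall x y, T x -> T y -> (x * y = y * x)%g].

Definition maximal_torus T :=
  is_torus T /\ forall T', is_torus T' -> T `<=` T' -> T' = T.

(* The roots of (SU(2))^r are [+/- alpha_j], one pair for each factor, and for
   every maximal torus the rank-one subgroup of [+/- alpha_j] is the [j]-th
   factor. *)
Definition root_subgroup (j : 'I_r) : set SU2pow :=
  [set g | forall i, i != j -> g i = 1%g].

(* the subgroup G_I generated by [T] and the rank-one subgroups indexed by [I] *)
Definition GI T I : set SU2pow :=
  smallest is_subgroup (T `|` \bigcup_(j in [set j | j \in I]) root_subgroup j).

Lemma GI_subgroup T I : is_subgroup (GI T I).
Proof. exact: is_subgroup_smallest. Qed.

Lemma GI_mono T I J : I \subset J -> GI T I `<=` GI T J.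
Proof.
move=> /fintype.subsetP IJ g gI B [sB AB]; apply: gI; split=> //.
apply: subset_trans AB; apply: setUS => h [j jI hj]; exists j => //.
exact: IJ.
Qed.

Definition coset_rel T I (g h : SU2pow) : bool :=
  `[< GI T I (g^-1 * h)%g >].

Lemma coset_rel_refl T I : reflexive (coset_rel T I).
Proof.
move=> g; apply/asboolP; rewrite mulVg.
by case: (GI_subgroup T I).
Qed.

Lemma coset_rel_sym T I : symmetric (coset_rel T I).
Proof.
suff S g h : coset_rel T I g h -> coset_rel T I h g.
  by move=> g h; apply/idP/idP; exact: S.
move=> /asboolP gh; apply/asboolP.
have [_ _ /(_ _ gh)] := GI_subgroup T I.
by rewrite invgM invgK.
Qed.

Lemma coset_rel_trans T I : transitive (coset_rel T I).
Proof.
move=> h g k /asboolP gh /asboolP hk; apply/asboolP.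
have [_ M _] := GI_subgroup T I.
by have := M _ _ gh hk; rewrite -mulgA mulVKg.
Qed.

Definition coset_equiv T I : equiv_rel SU2pow :=
  EquivRel (coset_rel T I) (@coset_rel_refl T I) (@coset_rel_sym T I)
    (@coset_rel_trans T I).

Definition coset_space T I : topologicalType :=
  quotient_topology {eq_quot coset_equiv T I}.

Definition coset_pi T I (g : SU2pow) : coset_space T I :=
  \pi_(quotient_topology {eq_quot coset_equiv T I}) g.

Definition coset_repr T I (q : coset_space T I) : SU2pow :=
  repr (q : quotient_topology {eq_quot coset_equiv T I}).

Lemma coset_reprK T I q : coset_pi T I (coset_repr q) = q.
Proof. exact: reprK. Qed.

Lemma coset_piP T I g h :
  GI T I (g^-1 * h)%g <-> coset_pi T I g = coset_pi T I h.
Proof.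
by split=> [gh|/eqmodP /asboolP //]; apply/eqmodP; exact/asboolP.
Qed.

Definition coset_proj T I J (q : coset_space T I) : coset_space T J :=
  coset_pi T J (coset_repr q).

Lemma coset_proj_pi T I J g : I \subset J ->
  coset_proj J (coset_pi T I g) = coset_pi T J g.
Proof.
move=> IJ; apply/coset_piP; apply: (GI_mono IJ); apply/coset_piP.
exact: coset_reprK.
Qed.

Lemma coset_proj_continuous T I J : I \subset J ->
  continuous (@coset_proj T I J).
Proof.
move=> IJ; apply/quotient_continuous.
rewrite (_ : _ \o _ = coset_pi T J); first exact: pi_continuous.
by apply/funext => g; exact: coset_proj_pi.
Qed.

End Subgroups.

Section Complexes.
Context (r : nat).

(* simplicial complexes on the vertex set {1, ..., r}, ghost vertices allowed *)
Record scomplex := SComplex {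
  faces :> {set {set 'I_r}};
  faces0 : finset.set0 \in faces;
  faces_sub : forall I J : {set 'I_r}, J \subset I -> I \in faces -> J \in faces }.

Definition face (K : scomplex) : Type := {I : {set 'I_r} | I \in faces K}.

Definition face_le (K : scomplex) : rel (face K) :=
  fun I J => \val I \subset \val J.

Definition face_incl (K L : scomplex) (KL : faces K \subset faces L)
    (I : face K) : face L :=
  exist _ (\val I) (fintype.subsetP KL (\val I) (valP I)).

End Complexes.

Section XK.
Context (R : realType) (r : nat) (T : set (SU2pow R r)).

Definition coset_diagram (K : scomplex r) : diagram (@face_le r K).
Proof.
refine (@Diagram (face K) (@face_le r K)
  (fun I => coset_space T (\val I))
  (fun I J _ => @coset_proj R r T (\val I) (\val J)) _ _ _).
- by move=> I J; exact: coset_proj_continuous.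
- by move=> I _ q; exact: coset_reprK.
- move=> I J L IJ JL IL q.
  by rewrite -(coset_reprK q) !coset_proj_pi.
Defined.

Definition XK (K : scomplex r) : topologicalType := hocolim R (coset_diagram K).

Definition XK_incl (K L : scomplex r) (KL : faces K \subset faces L) :
    XK K -> XK L :=
  @hocolim_map R _ _ _ _ (coset_diagram K) (coset_diagram L) (face_incl KL)
    (fun _ _ IJ => IJ) (fun _ x => x).

Lemma XK_incl_pi (K L : scomplex r) (KL : faces K \subset faces L)
    n (c : chain (@face_le r K) n) (x : coset_diagram K (c ord0))
    (t : simplex R n) :
  XK_incl KL (hocolim_pi (bk_point x t)) =
  hocolim_pi (@bk_point R _ _ (coset_diagram L) n
    (chain_push (phi := face_incl KL) (le' := @face_le r L)
       (fun _ _ IJ => IJ) c) x t).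
Proof. by rewrite /XK_incl hocolim_map_pi. Qed.

Lemma XK_incl_continuous (K L : scomplex r) (KL : faces K \subset faces L) :
  continuous (XK_incl KL).
Proof. by apply: hocolim_map_continuous => // I x. Qed.

End XK.

Section PolyhedralProduct.
Context (R : realType) (r : nat).

Definition D3 : set 'rV[R]_3 := [set v | \sum_i v 0 i ^+ 2 <= 1].
Definition S2 : set 'rV[R]_3 := [set v | \sum_i v 0 i ^+ 2 = 1].

Definition polyprod_set (K : scomplex r) : set {ffun 'I_r -> 'rV[R]_3} :=
  \bigcup_(I in [set I | I \in faces K])
    [set y | (forall j, j \in I -> D3 (y j)) /\
             (forall j, j \notin I -> S2 (y j))].

Definition polyprod (K : scomplex r) : topologicalType := polyprod_set K.

Lemma polyprod_setS (K L : scomplex r) : faces K \subset faces L ->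
  polyprod_set K `<=` polyprod_set L.
Proof. by move=> /fintype.subsetP KL y [I IK yI]; exists I => //; exact: KL. Qed.

Definition polyprod_incl (K L : scomplex r) (KL : faces K \subset faces L)
    (y : polyprod K) : polyprod L :=
  exist _ (\val (y : polyprod_set K))
    (mem_set (polyprod_setS KL (set_mem (valP (y : polyprod_set K))))).

End PolyhedralProduct.

(* Main.v *)
(** By maximality, [T] is the subgroup whose [j]-th factor rotates R^3 about a
    fixed unit vector [n_j], for each [j].  With [v_j(g)] the image of [n_j]
    under the rotation given by [g_j], the coset space [G/G_I] is the product over [j \notin I] of
    the spheres traced by the [v_j].  A point of the homotopy colimit, given by
    a chain [c_0 <= ... <= c_m], a coset [g G_(c_0)] and barycentric
    coordinates [t], is sent to the point of the polyhedral product whose [j]-th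
    coordinate is [s_j v_j(g)], where [s_j] is the sum of the [t_a] with
    [j \notin c_a].  This continuous map, clearly natural in the complex, is
    even a homeomorphism: if all [t_a] are positive, the [c_a] are exactly the
    sublevel sets [{j | s_j < l}] for [0 < l <= 1] and the [t_a] are the lengths
    of the corresponding intervals of [l], so the point is determined by its
    image; and a continuous bijection from a compact space to a Hausdorff space
    is a homeomorphism. *)

Require Import Defs.
From Stdlib Require Import Relation_Operators.
From mathcomp Require Import all_boot all_order all_algebra.
From mathcomp Require Import complex spectral ring lra.
From mathcomp Require Import all_classical all_reals topology normedtype.
From mathcomp Require Import unstable trigo.
Import Order.TTheory GRing.Theory Num.Theory numFieldNormedType.Exports.

Set Implicit Arguments.
Unset Strict Implicit.
Unset Printing Implicit Defensive.

Local Open Scope classical_set_scope.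
Local Open Scope ring_scope.

(** * General topology *)

Section GeneralTopology.

Lemma comp_continuous (X Y Z : topologicalType) (f : X -> Y) (g : Y -> Z) :
  continuous f -> continuous g -> continuous (fun x => g (f x)).
Proof. by move=> cf cg x; apply: continuous_comp; [exact: cf|exact: cg]. Qed.

Lemma mx_continuous (Z T : topologicalType) m n (F : Z -> 'M[T]_(m, n)) :
  (forall i j, continuous (fun z => F z i j)) -> continuous F.
Proof.
move=> cF z A [P nP sPA]; rewrite nbhs_simpl /=.
apply: (@filterS _ (nbhs z) _ (fun w => forall i j, P i j (F w i j))).
  by move=> w /sPA.
by apply: filter_forall => i; apply: filter_forall => j; apply/cF/nP.
Qed.

Lemma mx_coord_continuous (T : topologicalType) m n i j :
  continuous (fun M : 'M[T]_(m, n) => M i j).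
Proof.
move=> M A nA; exists (fun i' j' => if (i' == i) && (j' == j) then A else setT).
  by move=> i' j'; case: ifP => [/andP[/eqP-> /eqP->]//|_]; exact: filterT.
by move=> N /(_ i j); rewrite !eqxx.
Qed.

Lemma prod_topology_continuous (Z : topologicalType) (I : Type)
    (T : I -> topologicalType) (F : Z -> prod_topology T) :
  (forall i, continuous (fun z => F z i)) -> continuous F.
Proof.
move=> cF z; apply/cvg_sup => i.
exact: (@continuous_comp_initial _ _ _ (fun f => f i) F (cF i) z).
Qed.

Lemma ffun_continuous (Z : topologicalType) (I : finType) (T : topologicalType)
    (F : Z -> {ffun I -> T}) :
  (forall i, continuous (fun z => F z i)) -> continuous F.
Proof.
move=> cF; apply: continuous_comp_initial.
exact: prod_topology_continuous.
Qed.

Lemma ffun_coord_continuous (I : finType) (T : topologicalType) (i : I) :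
  continuous (fun f : {ffun I -> T} => f i).
Proof.
move=> f; apply: (@continuous_comp _ _ _
  (fun f : {ffun I -> T} => (f : prod_topology (fun=> T))) (fun g => g i)).
  exact: initial_continuous.
exact: (@proj_continuous I (fun=> T) i).
Qed.

Lemma hausdorff_inj (X Y : topologicalType) (f : X -> Y) :
  continuous f -> injective f -> hausdorff_space Y -> hausdorff_space X.
Proof.
move=> cf injf hY p q pq; apply/injf/hY => A B nA nB.
have [x [Ax Bx]] := pq _ _ (cf _ _ nA) (cf _ _ nB).
by exists (f x).
Qed.

Lemma ffun_hausdorff (I : finType) (T : topologicalType) :
  hausdorff_space T -> hausdorff_space {ffun I -> T}.
Proof.
move=> hT; have h := @hausdorff_product I (fun=> T) (fun=> hT).
apply: (@hausdorff_inj _ _ (fun f : {ffun I -> T} => (f : prod_topology (fun=> T)))).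
- exact: initial_continuous.
- by move=> f g fg; apply/ffunP => i; rewrite fg.
- exact: h.
Qed.

Lemma ffun_compact (I : finType) (T : topologicalType) :
  compact [set: T] -> compact [set: {ffun I -> T}].
Proof.
move=> cT; have c := @tychonoff I (fun=> T) (fun=> setT) (fun=> cT).
pose F (f : prod_topology (fun _ : I => T)) : {ffun I -> T} := finfun f.
have cF : continuous F.
  apply: ffun_continuous => i.
  have -> : (fun z => F z i) = proj i by apply/funext => f; rewrite ffunE.
  exact: proj_continuous.
have -> : [set: {ffun I -> T}] = F @` setT.
  by apply/seteqP; split=> // f _; exists f => //; apply/ffunP => i; rewrite ffunE.
apply: continuous_compact; first exact: continuous_subspaceT.
by move: c; congr compact; apply/seteqP; split.
Qed.

(** An ultrafilter on the subspace is pushed forward to [T]; its limit there lies in [A], and open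
    sets of the subspace are traces of open sets of [T]. *)
Lemma compact_set_type (T : topologicalType) (A : set T) :
  compact A -> compact [set: A].
Proof.
rewrite [in X in X -> _]compact_ultra compact_ultra => cA F FU _.
have [] := cA (set_val @ F).
(* Maximality of the image filter: if [B] is in [G] but its preimage is not in [F], then the
   complement of [B] is in [G] too, which contradicts properness. *)
- split=> [|G PG sG]; first exact: fmap_proper_filter.
  apply/seteqP; split=> [|B FB]; last exact: sG.
  move=> B GB; rewrite nbhs_simpl /=.
  have [//|nFB] := in_ultra_setVsetC (set_val @^-1` B) FU.
  have : G (~` B) by apply: sG.
  by move=> /(filterI GB); rewrite setICr => /filter_not_empty.
- by apply: (@filterS _ F _ setT) => [x _|];
    [exact: set_mem (valP x)|exact: filterT].
move=> p [Ap Fp]; exists (exist _ p (mem_set Ap)); split=> // U.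
by move=> [_ [[W oW <-] Wp]] /filterS; apply; apply: Fp; exact: open_nbhs_nbhs.
Qed.

Lemma set_type_continuous (Z T : topologicalType) (A : set T) (F : Z -> A) :
  continuous (fun z => set_val (F z)) -> continuous F.
Proof. exact: continuous_comp_initial. Qed.

(** The preimage under [g] of a closed set is its image under [f], hence compact, hence closed. *)
Lemma compact_hausdorff_inverse (X Y : topologicalType) (f : X -> Y) (g : Y -> X) :
  compact [set: X] -> hausdorff_space Y -> continuous f ->
  cancel f g -> cancel g f -> continuous g.
Proof.
move=> cX hY cf fK gK; apply/continuous_closedP => A cA.
have -> : g @^-1` A = f @` A.
  by apply/seteqP; split=> [y Ay|_ [x Ax <-]]; [exists (g y)|rewrite /= fK].
apply: compact_closed => //; apply: continuous_compact.
  exact: continuous_subspaceT.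
exact: (subclosed_compact cA cX).
Qed.

Lemma sum_continuous (R : realType) (Z : topologicalType) (I : Type) (s : seq I)
    (P : pred I) (F : I -> Z -> R) :
  (forall i, P i -> continuous (F i)) ->
  continuous (fun z => \sum_(i <- s | P i) F i z).
Proof.
move=> cF z; apply: cvg_big; first exact: add_continuous.
by move=> i Pi; exact: cF.
Qed.

End GeneralTopology.

(** * Continuity of real and imaginary parts *)

Notation cRe := complex.Re.
Notation cIm := complex.Im.

Section ComplexTopology.
Context (R : realType).

(** Balls of [R[i]] have radii in [R[i]]; this compares them with boxes of real intervals. Half the
    radius suffices, since twice the square of [e / 2] is below the square of [e]. *)
Lemma normc_bounds (z : R[i]) (e : R) :
  (`|cRe z| < e / 2 -> `|cIm z| < e / 2 -> `|z| < e%:C%C) /\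
  (`|z| < e%:C%C -> `|cRe z| < e /\ `|cIm z| < e).
Proof.
rewrite normc_def ltcR; set x := cRe z; set y := cIm z.
have s0 : 0 <= x ^+ 2 + y ^+ 2 by rewrite addr_ge0 // sqr_ge0.
split=> [hx hy|h].
  have e0 : 0 < e by have := normr_ge0 x; lra.
  rewrite -[ltRHS]ger0_norm ?ltW // -sqrtr_sqr ltr_sqrt; last by rewrite exprn_gt0.
  rewrite -(real_normK (num_real x)) -(real_normK (num_real y)).
  move: (normr_ge0 x) (normr_ge0 y) hx hy.
  move: `|x| `|y| => p q p0 q0 hp hq.
  have : p ^+ 2 < (e / 2) ^+ 2 by rewrite ltr_pXn2r ?nnegrE //; lra.
  have : q ^+ 2 < (e / 2) ^+ 2 by rewrite ltr_pXn2r ?nnegrE //; lra.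
  have : 0 < e ^+ 2 by rewrite exprn_gt0.
  by rewrite expr_div_n; lra.
have e0 : 0 < e by apply: le_lt_trans h; exact: sqrtr_ge0.
by split; apply: le_lt_trans h; rewrite -sqrtr_sqr ler_sqrt //;
  rewrite ?lerDl ?lerDr sqr_ge0.
Qed.

Lemma Re_continuous : continuous (@cRe R).
Proof.
move=> z A /nbhs_ballP[e /= e0 eA]; apply/nbhs_ballP; exists e%:C%C => /=.
  by rewrite ltcR.
move=> w zw; apply: eA; rewrite /ball /=.
by have [] := (normc_bounds (z - w) e).2 zw; rewrite !raddfB.
Qed.

Lemma Im_continuous : continuous (@cIm R).
Proof.
move=> z A /nbhs_ballP[e /= e0 eA]; apply/nbhs_ballP; exists e%:C%C => /=.
  by rewrite ltcR.
move=> w zw; apply: eA; rewrite /ball /=.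
by have [] := (normc_bounds (z - w) e).2 zw; rewrite !raddfB.
Qed.

Lemma complex_continuous (Z : topologicalType) (f g : Z -> R) :
  continuous f -> continuous g -> continuous (fun z => (f z +i* g z)%C : R[i]).
Proof.
move=> cf cg z A /nbhs_ballP[e /= e0 eA]; rewrite nbhs_simpl /=.
(* A positive complex number is real. *)
have eE : e = (cRe e)%:C%C by rewrite RRe_real // gtr0_real.
have e20 : 0 < cRe e / 2 by rewrite divr_gt0 // -ltcR -eE.
near=> w; apply: eA; rewrite eE.
apply: (normc_bounds ((f z +i* g z)%C - (f w +i* g w)%C) _).1 => /=; near: w.
  exact: (@cvgr_dist_lt _ _ _ _ _ _ _ (cf z) _ e20).
exact: (@cvgr_dist_lt _ _ _ _ _ _ _ (cg z) _ e20).
Unshelve. all: by end_near. Qed.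

End ComplexTopology.

(** * SU(2) as the unit quaternions *)

Section Quaternions.
Context (R : realType).
Implicit Types (U V : SU2 R) (u v : 'rV[R]_3).

Definition vec3 (x y z : R) : 'rV[R]_3 := \row_i [:: x; y; z]`_i.

Lemma vec3P u v :
  u 0 0 = v 0 0 -> u 0 1 = v 0 1 -> u 0 2 = v 0 2 -> u = v.
Proof.
move=> h0 h1 h2; apply/rowP => -[[|[|[|//]]] h].
- by rewrite (_ : Ordinal h = 0) //; exact: val_inj.
- by rewrite (_ : Ordinal h = 1) //; exact: val_inj.
- by rewrite (_ : Ordinal h = 2) //; exact: val_inj.
Qed.

Lemma sum3E (F : 'I_3 -> R) : \sum_i F i = F 0 + F 1 + F 2.
Proof.
rewrite !big_ord_recr big_ord0 /= add0r; congr (F _ + F _ + F _);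
  exact: val_inj.
Qed.

Lemma S2E v : S2 v = (v 0 0 ^+ 2 + v 0 1 ^+ 2 + v 0 2 ^+ 2 = 1).
Proof. by rewrite /S2 /= sum3E. Qed.

(** The first row of a matrix in SU(2) determines it; its four real coordinates are those of a unit
    quaternion, split into real part and imaginary vector. *)
Definition quat U : R * 'rV[R]_3 :=
  (cRe (\val U 0 0),
   vec3 (cIm (\val U 0 0)) (cRe (\val U 0 1)) (cIm (\val U 0 1))).

Definition quat_mx (q : R * 'rV[R]_3) : 'M[R[i]]_2 :=
  \matrix_(i, j)
    if i == 0 then if j == 0 then (q.1 +i* q.2 0 0)%C else (q.2 0 1 +i* q.2 0 2)%C
    else if j == 0 then (- q.2 0 1 +i* q.2 0 2)%C else (q.1 -i* q.2 0 0)%C.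

Lemma mx2P (A B : 'M[R[i]]_2) :
  A 0 0 = B 0 0 -> A 0 1 = B 0 1 -> A 1 0 = B 1 0 -> A 1 1 = B 1 1 -> A = B.
Proof.
have H (i : 'I_2) : i = 0 \/ i = 1.
  by case: i => -[|[|//]] h; [left|right]; exact: val_inj.
by move=> *; apply/matrixP => i j; case: (H i) => ->; case: (H j) => ->.
Qed.

Lemma sum2E (S : nmodType) (F : 'I_2 -> S) : \sum_i F i = F 0 + F 1.
Proof.
rewrite !big_ord_recr big_ord0 /= add0r; congr (F _ + F _); exact: val_inj.
Qed.

Lemma det_mx22 (A : 'M[R[i]]_2) : \det A = A 0 0 * A 1 1 - A 0 1 * A 1 0.
Proof.
rewrite (expand_det_row _ 0) sum2E /cofactor !det_mx11 !mxE /=.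
rewrite expr0 expr1 mul1r mulN1r mulrN; congr (_ * A _ _ - _ * A _ _);
  exact: val_inj.
Qed.

Lemma conjC_complex (z : R[i]) : (z^*)%R = conjc z.
Proof. by []. Qed.

Lemma SU2_entries U : [/\ \val U 1 1 = ((\val U 0 0)^*)%R,
  \val U 1 0 = - ((\val U 0 1)^*)%R
  & \val U 0 0 * ((\val U 0 0)^*)%R + \val U 0 1 * ((\val U 0 1)^*)%R = 1].
Proof.
have [/unitarymxP uU dU] := set_mem (valP U).
have /matrixP uU' := uU; move: (uU' 0 0) (uU' 1 0) dU.
rewrite !mxE !sum2E !mxE det_mx22 /=.
set a := \val U 0 0; set b := \val U 0 1; set c := \val U 1 0.
set d := \val U 1 1 => h1 h2 h3.
have h2' : (a^*)%R * c + (b^*)%R * d = 0 by apply: etrans h2; ring.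
split=> //; apply/eqP; rewrite -subr_eq0; apply/eqP.
(* The difference is an explicit combination of three relations: norm one of the first row,
   orthogonality of the rows, determinant one. *)
- transitivity (- d * (a * (a^*)%R + b * (b^*)%R - 1)
    + b * ((a^*)%R * c + (b^*)%R * d) + (a^*)%R * (a * d - b * c - 1));
    first by ring.
  by rewrite h1 h2' h3; ring.
- transitivity (- c * (a * (a^*)%R + b * (b^*)%R - 1)
    + a * ((a^*)%R * c + (b^*)%R * d) - (b^*)%R * (a * d - b * c - 1));
    first by ring.
  by rewrite h1 h2' h3; ring.
Qed.

Lemma quatK U : quat_mx (quat U) = \val U.
Proof.
have [h11 h10 _] := SU2_entries U.
apply: mx2P; rewrite ?h11 ?h10 /quat_mx !mxE /=.
- by case: (\val U 0 0).
- by case: (\val U 0 1).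
- by rewrite conjC_complex; case: (\val U 0 1) => x y; apply/eqP;
  rewrite eq_complex /= opprK !eqxx.
- by rewrite conjC_complex; case: (\val U 0 0).
Qed.

Lemma quat_norm U : (quat U).1 ^+ 2 + ((quat U).2 0 0 ^+ 2 +
  (quat U).2 0 1 ^+ 2 + (quat U).2 0 2 ^+ 2) = 1.
Proof.
have [_ _] := SU2_entries U; rewrite /quat !mxE /= !conjC_complex.
case: (\val U 0 0) => x y; case: (\val U 0 1) => z w /= [h _].
by rewrite -h; ring.
Qed.

Lemma quat_inj : injective quat.
Proof. by move=> U V UV; apply: val_inj; rewrite -!quatK UV. Qed.

Lemma quat_surj (q : R * 'rV[R]_3) :
  q.1 ^+ 2 + (q.2 0 0 ^+ 2 + q.2 0 1 ^+ 2 + q.2 0 2 ^+ 2) = 1 ->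
  exists U, quat U = q.
Proof.
case: q => [a v] /= h.
have hU : quat_mx (a, v) \in @SU2_set R.
  apply/mem_set; split.
    apply/unitarymxP; apply: mx2P; rewrite !mxE sum2E !mxE /= !conjC_complex /=;
    apply/eqP; rewrite eq_complex /=; apply/andP; split; apply/eqP;
    rewrite -?h; ring.
  rewrite det_mx22 !mxE /=.
  apply/eqP; rewrite eq_complex /=; apply/andP; split; apply/eqP;
    rewrite -?h; ring.
pose U : SU2 R := exist (fun A => A \in @SU2_set R) _ hU.
exists U; rewrite /quat /= !mxE /=; congr pair.
by apply: vec3P; rewrite !mxE.
Qed.

Lemma val_SU2M U V : \val (U * V)%g = \val U *m \val V.
Proof. by []. Qed.

Lemma quatM U V (p := quat U) (q := quat V) :
  quat (U * V)%g =
  (p.1 * q.1 - p.2 0 0 * q.2 0 0 - p.2 0 1 * q.2 0 1 - p.2 0 2 * q.2 0 2,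
   vec3 (p.1 * q.2 0 0 + p.2 0 0 * q.1 + p.2 0 1 * q.2 0 2 - p.2 0 2 * q.2 0 1)
        (p.1 * q.2 0 1 - p.2 0 0 * q.2 0 2 + p.2 0 1 * q.1 + p.2 0 2 * q.2 0 0)
        (p.1 * q.2 0 2 + p.2 0 0 * q.2 0 1 - p.2 0 1 * q.2 0 0 + p.2 0 2 * q.1)).
Proof.
have hM i j : \val (U * V)%g i j =
    \val U i 0 * quat_mx q 0 j + \val U i 1 * quat_mx q 1 j.
  by rewrite val_SU2M mxE sum2E quatK.
rewrite {1}/quat !hM -(quatK U) !mxE /= -/p.
congr pair; first by ring.
by apply: vec3P; rewrite !mxE /=; ring.
Qed.

Lemma quat1 : quat 1%g = (1, 0).
Proof.
rewrite /quat /= !mxE /=; congr pair; by apply: vec3P; rewrite !mxE.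
Qed.

Lemma SU2_continuous (Z : topologicalType) (F : Z -> SU2 R) :
  continuous (fun z => (quat (F z)).1) -> continuous (fun z => (quat (F z)).2) ->
  continuous F.
Proof.
move=> c1 c2; apply: set_type_continuous.
have -> : (fun z => set_val (F z)) = (fun z => quat_mx (quat (F z))).
  by apply/funext => z; rewrite quatK.
have cc (k : 'I_3) : continuous (fun z => (quat (F z)).2 0 k).
  exact: (comp_continuous c2 (@mx_coord_continuous R 1 3 0 k)).
have cN (f : Z -> R) : continuous f -> continuous (fun z => - f z).
  by move=> cf z; apply: cvgN; exact: cf.
apply: mx_continuous => i j.
rewrite /quat_mx; under eq_fun do rewrite mxE.
by case: (i == 0); case: (j == 0); apply: complex_continuous => //; apply: cN.
Qed.

Lemma SU2_entry_continuous i j : continuous (fun U => \val U i j).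
Proof.
apply: (comp_continuous (f := fun U : SU2 R => \val U) (g := fun M => M i j)).
  exact: initial_continuous.
exact: mx_coord_continuous.
Qed.

Lemma quat1_continuous : continuous (fun U => (quat U).1).
Proof. exact: (comp_continuous (@SU2_entry_continuous 0 0) (@Re_continuous R)). Qed.

Lemma quat2_continuous : continuous (fun U => (quat U).2).
Proof.
apply: mx_continuous => i j.
case: j => -[|[|[|//]]] h; rewrite /quat /vec3; under eq_fun do rewrite mxE /=.
- exact: (comp_continuous (@SU2_entry_continuous _ _) (@Im_continuous R)).
- exact: (comp_continuous (@SU2_entry_continuous _ _) (@Re_continuous R)).
- exact: (comp_continuous (@SU2_entry_continuous _ _) (@Im_continuous R)).
Qed.

End Quaternions.
(** * The action of SU(2) on the 2-sphere *)

Section Rotations.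
Context (R : realType).
Implicit Types (U V : SU2 R) (u v n : 'rV[R]_3) (q : R * 'rV[R]_3).

(* [q v q^*] for a quaternion [q] and an imaginary quaternion [v] *)
Definition rotq q v : 'rV[R]_3 :=
  let: (a, b, c, d) := (q.1, q.2 0 0, q.2 0 1, q.2 0 2) in
  let: (x, y, z) := (v 0 0, v 0 1, v 0 2) in
  let s := a ^+ 2 - (b ^+ 2 + c ^+ 2 + d ^+ 2) in
  let t := 2 * (b * x + c * y + d * z) in
  vec3 (s * x + t * b + 2 * a * (c * z - d * y))
       (s * y + t * c + 2 * a * (d * x - b * z))
       (s * z + t * d + 2 * a * (b * y - c * x)).

Definition rot U v := rotq (quat U) v.

Lemma rotM U V v : rot (U * V)%g v = rot U (rot V v).
Proof.
rewrite /rot quatM; move: (quat U) (quat V) => [a p] [b q] /=.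
by apply: vec3P; rewrite !mxE /= ?mxE /=; ring.
Qed.

Lemma rot1 v : rot 1%g v = v.
Proof. by rewrite /rot quat1; apply: vec3P; rewrite !mxE /= ?mxE; ring. Qed.

Lemma rot_S2 U v : S2 v -> S2 (rot U v).
Proof.
rewrite !S2E => hv; have hq := quat_norm U.
transitivity (((quat U).1 ^+ 2 + ((quat U).2 0 0 ^+ 2 +
  (quat U).2 0 1 ^+ 2 + (quat U).2 0 2 ^+ 2)) ^+ 2 *
  (v 0 0 ^+ 2 + v 0 1 ^+ 2 + v 0 2 ^+ 2)).
  by rewrite /rot !mxE /=; ring.
by rewrite hq hv expr1n mul1r.
Qed.

Lemma sqr_sum_eq0 (x y z : R) : x ^+ 2 + y ^+ 2 + z ^+ 2 = 0 ->
  [/\ x = 0, y = 0 & z = 0].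
Proof.
move=> h; have := sqr_ge0 x; have := sqr_ge0 y; have := sqr_ge0 z => hz hy hx.
by split; apply/eqP; rewrite -sqrf_eq0; apply/eqP; lra.
Qed.

(** The axis of a rotation is spanned by the imaginary part [w] of its quaternion. If [n] is fixed,
    pairing the image of [n] with [n] gives equality in the Cauchy-Schwarz inequality for [w] and
    [n]. The case [b = 0] is that of the central elements. *)
Lemma rot_fixP U n : S2 n ->
  rot U n = n <-> exists b, (quat U).2 = b *: n.
Proof.
rewrite S2E => hn; have := quat_norm U; rewrite /rot.
case: (quat U) => a w /= hq; split=> [h|[b wE]]; last first.
  move: hq; rewrite wE !mxE => hq.
  (* Multiplying the right-hand side by the norm of the quaternion makes both sides homogeneous. *)
  have E k : k = (a ^+ 2 + ((b * n 0 0) ^+ 2 + (b * n 0 1) ^+ 2 +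
    (b * n 0 2) ^+ 2)) * k by rewrite hq mul1r.
  by apply: vec3P; rewrite !mxE /= ?mxE [RHS]E; ring.
have := (congr1 (fun m : 'rV_3 => m 0 0) h, congr1 (fun m : 'rV_3 => m 0 1) h,
  congr1 (fun m : 'rV_3 => m 0 2) h); rewrite !mxE /= => -[[]].
move: hq hn; set x := n 0 0; set y := n 0 1; set z := n 0 2.
set p := w 0 0; set q := w 0 1; set r := w 0 2 => hq hn h0 h1 h2.
exists (p * x + q * y + r * z).
set L0 := (X in X = x) in h0; set L1 := (X in X = y) in h1.
set L2 := (X in X = z) in h2.
have hE : (a ^+ 2 - (p ^+ 2 + q ^+ 2 + r ^+ 2)) * (x ^+ 2 + y ^+ 2 + z ^+ 2) +
    2 * (p * x + q * y + r * z) ^+ 2 = L0 * x + L1 * y + L2 * z.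
  by rewrite /L0 /L1 /L2; ring.
have hE2 : L0 * x + L1 * y + L2 * z = 1 by rewrite h0 h1 h2 -hn; ring.
move: hE; rewrite hE2 hn mulr1; set b := p * x + q * y + r * z => hE.
have hb : p * x + q * y + r * z = b by [].
(* The squared length of [w - b n] is the squared length of [w] minus the square of [b], which
   vanishes by [hE] and [hq]. *)
have [] : [/\ p - b * x = 0, q - b * y = 0 & r - b * z = 0].
  apply: sqr_sum_eq0.
  transitivity (p ^+ 2 + q ^+ 2 + r ^+ 2 - 2 * b * (p * x + q * y + r * z) +
    b ^+ 2 * (x ^+ 2 + y ^+ 2 + z ^+ 2)); first by move: b {hE hb} => b; ring.
  by rewrite hn hb; move: hE hq; clearbody b; lra.
by move=> e0 e1 e2; apply: vec3P; rewrite mxE -/x -/y -/z; apply/eqP;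
  rewrite -subr_eq0; apply/eqP.
Qed.

(** The stabilizer of [n] consists of quaternions [a + b n], which multiply like complex numbers. *)
Lemma rot_fix_comm U V n : S2 n -> rot U n = n -> rot V n = n ->
  (U * V = V * U)%g.
Proof.
move=> hn /(rot_fixP _ hn)[b hb] /(rot_fixP _ hn)[c hc].
apply: quat_inj; rewrite !quatM hb hc /=; congr pair; rewrite ?mxE; first by ring.
by apply: vec3P; rewrite !mxE /= ?mxE; ring.
Qed.

(** The commutator [pq - qp] of two quaternions is twice the cross product of their imaginary parts.
    As [b] is nonzero, the imaginary part of [U] has zero cross product with [n], so it is a
    multiple of [n]. *)
Lemma comm_rot_fix U V n (b : R) : S2 n -> b != 0 -> (quat V).2 = b *: n ->
  (U * V = V * U)%g -> rot U n = n.
Proof.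
move=> hn b0 hb /(congr1 (@quat R)) h; apply/rot_fixP => //.
move: h hb; rewrite !quatM; case: (quat U) (quat V) => [a w] [c m] /= [_ + mE].
rewrite {m}mE => h.
have := (congr1 (fun m : 'rV_3 => m 0 0) h, congr1 (fun m : 'rV_3 => m 0 1) h,
  congr1 (fun m : 'rV_3 => m 0 2) h); rewrite !mxE /= ?mxE => -[[]].
move: hn; rewrite S2E.
set x := n 0 0; set y := n 0 1; set z := n 0 2.
set p := w 0 0; set q := w 0 1; set r := w 0 2 => hn h0 h1 h2.
have E k : 2 * b * k = 0 -> k = 0.
  by move=> /eqP; rewrite !mulf_eq0 (negPf b0) pnatr_eq0 /= => /eqP.
have e0 : q * z - r * y = 0 by apply: E; lra.
have e1 : r * x - p * z = 0 by apply: E; lra.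
have e2 : p * y - q * x = 0 by apply: E; lra.
exists (p * x + q * y + r * z); apply: vec3P; rewrite mxE -/x -/y -/z -/p -/q -/r.
- transitivity (p * (x ^+ 2 + y ^+ 2 + z ^+ 2)); first by rewrite hn mulr1.
  transitivity ((p * x + q * y + r * z) * x + y * (p * y - q * x)
    - z * (r * x - p * z)); first by ring.
  by rewrite e1 e2; ring.
- transitivity (q * (x ^+ 2 + y ^+ 2 + z ^+ 2)); first by rewrite hn mulr1.
  transitivity ((p * x + q * y + r * z) * y - x * (p * y - q * x)
    + z * (q * z - r * y)); first by ring.
  by rewrite e0 e2; ring.
- transitivity (r * (x ^+ 2 + y ^+ 2 + z ^+ 2)); first by rewrite hn mulr1.
  transitivity ((p * x + q * y + r * z) * z + x * (r * x - p * z)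
    - y * (q * z - r * y)); first by ring.
  by rewrite e0 e1; ring.
Qed.

(** The imaginary unit quaternion [w] acts as the half-turn about [w]. *)
Lemma half_turn w : S2 w -> exists U, forall n,
  rot U n = (2 * (w 0 0 * n 0 0 + w 0 1 * n 0 1 + w 0 2 * n 0 2)) *: w - n.
Proof.
rewrite S2E => hw; have [|U hU] := @quat_surj R (0, w).
  by rewrite /= hw expr0n add0r.
exists U => n; rewrite /rot hU.
have E k : k = (w 0 0 ^+ 2 + w 0 1 ^+ 2 + w 0 2 ^+ 2) * k by rewrite hw mul1r.
apply: vec3P; rewrite !mxE /=.
- by rewrite [X in _ = _ - X]E; ring.
- by rewrite [X in _ = _ - X]E; ring.
- by rewrite [X in _ = _ - X]E; ring.
Qed.

Lemma S2_normalize u (k := u 0 0 ^+ 2 + u 0 1 ^+ 2 + u 0 2 ^+ 2) :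
  k != 0 -> S2 ((Num.sqrt k)^-1 *: u).
Proof.
move=> k0; rewrite S2E !mxE !exprMn -!mulrDr -/k exprVn sqr_sqrtr ?mulVf //.
by rewrite !addr_ge0 ?sqr_ge0.
Qed.

Lemma S2_orthogonal n : S2 n -> exists w, S2 w /\
  w 0 0 * n 0 0 + w 0 1 * n 0 1 + w 0 2 * n 0 2 = 0.
Proof.
rewrite S2E => hn.
(* This vector is orthogonal to [n] and vanishes only if [n] lies on the third axis; the first basis
   vector then serves. *)
pose u := vec3 (- n 0 1) (n 0 0) 0.
pose k := u 0 0 ^+ 2 + u 0 1 ^+ 2 + u 0 2 ^+ 2.
have [k0|k0] := eqVneq k 0.
  exists (vec3 1 0 0); rewrite S2E !mxE /=; split; first by ring.
  have [] := sqr_sum_eq0 k0; rewrite !mxE /= => _ -> _; ring.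
exists ((Num.sqrt k)^-1 *: u); split; first exact: S2_normalize.
rewrite !mxE /=; ring.
Qed.

(** The half-turn about the bisector of [n] and [v] exchanges them; if [v = - n], a half-turn about
    any axis orthogonal to [n] does. *)
Lemma rot_transitive n v : S2 n -> S2 v -> exists U, rot U n = v.
Proof.
move=> hn hv.
pose u := n + v; pose k := u 0 0 ^+ 2 + u 0 1 ^+ 2 + u 0 2 ^+ 2.
have [k0|k0] := eqVneq k 0.
  have [w [hw wn]] := S2_orthogonal hn; have [U hU] := half_turn hw.
  exists U; rewrite hU wn mulr0 scale0r sub0r.
  have [] := sqr_sum_eq0 k0; rewrite !mxE => e0 e1 e2.
  by apply: vec3P; rewrite !mxE; lra.
have [U hU] := half_turn (S2_normalize k0).
exists U; rewrite hU scalerA.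
have k_ge0 : 0 <= k by rewrite !addr_ge0 ?sqr_ge0.
(* For unit vectors, the squared length of [u = n + v] is twice the inner product of [u] and [n]. *)
set c := _ * _; suff -> : c = 1 by rewrite scale1r addrAC subrr add0r.
have -> : c = 2 * (u 0 0 * n 0 0 + u 0 1 * n 0 1 + u 0 2 * n 0 2)
    * (Num.sqrt k)^-1 ^+ 2 by rewrite /c -/k !mxE; ring.
rewrite exprVn sqr_sqrtr // -[RHS](divff k0); congr (_ / _).
move: hn hv; rewrite /k !S2E !mxE => hn hv.
rewrite !sqrrD; lra.
Qed.

(** The common shape of the three coordinates of [rotq]; [e], [f] and [g] stand for the quaternion
    components that change from one to the next. *)
Lemma rot_coord_continuous (Z : topologicalType) (a b c d e f g : Z -> R)
    (x y z k l m : R) :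
  continuous a -> continuous b -> continuous c -> continuous d ->
  continuous e -> continuous f -> continuous g ->
  continuous (fun w => (a w ^+ 2 - (b w ^+ 2 + c w ^+ 2 + d w ^+ 2)) * k +
    2 * (b w * x + c w * y + d w * z) * e w + 2 * a w * (f w * l - g w * m)).
Proof.
move=> ca cb cc cd ce cf cg.
have D (f1 f2 : Z -> R) : continuous f1 -> continuous f2 ->
    continuous (fun w => f1 w + f2 w).
  by move=> c1 c2 w; apply: cvgD; [exact: c1|exact: c2].
have N (f1 : Z -> R) : continuous f1 -> continuous (fun w => - f1 w).
  by move=> c1 w; apply: cvgN; exact: c1.
have M (f1 f2 : Z -> R) : continuous f1 -> continuous f2 ->
    continuous (fun w => f1 w * f2 w).
  by move=> c1 c2 w; apply: cvgM; [exact: c1|exact: c2].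
have K (t : R) : continuous (fun _ : Z => t) by move=> w; exact: cvg_cst.
apply: (D _ _ (D _ _ (M _ _ (D _ _ (M _ _ ca ca) (N _ (D _ _
  (D _ _ (M _ _ cb cb) (M _ _ cc cc)) (M _ _ cd cd)))) (K k)) _) _).
  apply: (M _ _ (M _ _ (K 2) _) ce).
  exact: (D _ _ (D _ _ (M _ _ cb (K x)) (M _ _ cc (K y))) (M _ _ cd (K z))).
exact: (M _ _ (M _ _ (K 2) ca) (D _ _ (M _ _ cf (K l)) (N _ (M _ _ cg (K m))))).
Qed.

Lemma rot_continuous v : continuous (fun U => rot U v).
Proof.
have cc (k : 'I_3) : continuous (fun U => (quat U).2 0 k).
  exact: (comp_continuous (@quat2_continuous R) (@mx_coord_continuous R 1 3 0 k)).
have ca := @quat1_continuous R.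
apply: mx_continuous => i -[[|[|[|//]]] h]; rewrite /rot /rotq;
  under eq_fun do rewrite mxE [nth _ _ _]/=; exact: rot_coord_continuous.
Qed.

End Rotations.

(** SU(2) is the continuous image of the unit sphere of R^4, which is closed in a cube. *)
Lemma SU2_compact (R : realType) : compact [set: SU2 R].
Proof.
pose F (v : 'rV[R]_4) : 'M[R[i]]_2 :=
  quat_mx (v 0 0, vec3 (v 0 1) (v 0 2) (v 0 3)).
pose N (v : 'rV[R]_4) : R :=
  v 0 0 ^+ 2 + (v 0 1 ^+ 2 + v 0 2 ^+ 2 + v 0 3 ^+ 2).
have cc k : continuous (fun v : 'rV[R]_4 => v 0 k).
  exact: mx_coord_continuous.
have cN (f : 'rV[R]_4 -> R) : continuous f -> continuous (fun v => - f v).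
  by move=> c1 w; exact: (cvgN (c1 w)).
have cX (f : 'rV[R]_4 -> R) : continuous f -> continuous (fun v => f v ^+ 2).
  by move=> c1 w; exact: (cvgM (c1 w) (c1 w)).
have cD (f g : 'rV[R]_4 -> R) : continuous f -> continuous g ->
    continuous (fun v => f v + g v).
  by move=> c1 c2 w; exact: (cvgD (c1 w) (c2 w)).
have cF : continuous F.
  apply: mx_continuous => i j; rewrite /F /quat_mx.
  under eq_fun do rewrite !mxE /=.
  by case: (i == 0); case: (j == 0); apply: complex_continuous => //; exact: cN.
have cNorm : continuous N.
  exact: (cD _ _ (cX _ (cc 0))
    (cD _ _ (cD _ _ (cX _ (cc 1)) (cX _ (cc 2))) (cX _ (cc 3)))).
have cS : compact [set v | N v = 1].
  apply: (@subclosed_compact _ _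
    [set v : 'rV[R]_4 | forall i, `[-1, 1]%classic (v 0 i)]).
  - exact: (closed_comp (fun v _ => cNorm v) (@closed_eq _ 1)).
  - apply: (@rV_compact R 4 (fun=> `[-1, 1]%classic)) => _.
    exact: segment_compact.
  - move=> v /= Nv i; rewrite in_itv /= -ler_norml.
    rewrite -(@ler_pXn2r _ 2) ?nnegrE // expr1n real_normK ?num_real // -Nv /N.
    have := sqr_ge0 (v 0 0); have := sqr_ge0 (v 0 1).
    have := sqr_ge0 (v 0 2); have := sqr_ge0 (v 0 3).
    by case: i => -[|[|[|[|//]]]] h;
      [rewrite (_ : Ordinal h = 0)|rewrite (_ : Ordinal h = 1)
      |rewrite (_ : Ordinal h = 2)|rewrite (_ : Ordinal h = 3)];
      try exact: val_inj; lra.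
apply: compact_set_type.
suff -> : @SU2_set R = F @` [set v | N v = 1].
  by apply: continuous_compact => //; exact: continuous_subspaceT.
apply/seteqP; split=> [A hA|_ [v Nv <-]].
  have [[a u] [/= hq <-]] : exists q : R * 'rV[R]_3, q.1 ^+ 2 +
      (q.2 0 0 ^+ 2 + q.2 0 1 ^+ 2 + q.2 0 2 ^+ 2) = 1 /\ quat_mx q = A.
    pose U : SU2 R := exist (fun A => A \in @SU2_set R) _ (mem_set hA).
    by exists (quat U); split; [exact: quat_norm|exact: quatK].
  exists (\row_i [:: a; u 0 0; u 0 1; u 0 2]`_i).
    by rewrite /= /N !mxE /= hq.
  rewrite /F !mxE /=; congr (quat_mx (_, _)).
  by apply: vec3P; rewrite !mxE.
have [|U hU] := @quat_surj R (v 0 0, vec3 (v 0 1) (v 0 2) (v 0 3)).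
  by rewrite !mxE /= -Nv.
by rewrite /F -hU quatK; exact: set_mem (valP U).
Qed.

(** * Circle subgroups of SU(2) *)

Section Circle.
Context (R : realType).

Lemma cos_sin_surj (a b : R) : a ^+ 2 + b ^+ 2 = 1 ->
  exists t, cos t = a /\ sin t = b.
Proof.
move=> ab.
have a1 : -1 <= a <= 1.
  rewrite -ler_norml -(@ler_pXn2r _ 2) ?nnegrE // expr1n real_normK ?num_real //.
  by have := sqr_ge0 b; lra.
have cE : cos (acos a) = a by rewrite acosK.
have sE : sin (acos a) = `|b|.
  by rewrite sin_acos // -sqrtr_sqr; congr Num.sqrt; rewrite -ab; ring.
have [b0|b0] := lerP 0 b.
  by exists (acos a); rewrite sE ger0_norm.
by exists (- acos a); rewrite cosN sinN sE ltr0_norm // opprK.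
Qed.

(** The parametrization is [cos t + sin t n], which reaches the whole stabilizer by [rot_fixP]. It
    serves to prove tori connected. *)
Lemma circle_param (n : 'rV[R]_3) : S2 n -> exists e : R -> SU2 R,
  [/\ continuous e, e 0 = 1%g, forall t, rot (e t) n = n
    & forall U, rot U n = n -> exists t, e t = U].
Proof.
move=> hn.
have /choice[e he] : forall t, exists U, quat U = (cos t, sin t *: n).
  move=> t; apply: quat_surj; rewrite !mxE !exprMn -!mulrDr.
  by move: hn; rewrite S2E => ->; rewrite mulr1 cos2Dsin2.
exists e; split.
- apply: SU2_continuous; under eq_fun do rewrite he /=.
    exact: continuous_cos.
  apply: mx_continuous => i j; under eq_fun do rewrite mxE.
  by move=> t; apply: cvgMl; exact: continuous_sin.
- by apply: quat_inj; rewrite he quat1 cos0 sin0 scale0r.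
- by move=> t; apply/rot_fixP => //; exists (sin t); rewrite he.
- move=> U /(rot_fixP _ hn)[b hb].
  have [|t [ct st]] := @cos_sin_surj (quat U).1 b.
    rewrite -[RHS](quat_norm U) hb !mxE !exprMn -!mulrDr.
    by move: hn; rewrite S2E => ->; rewrite mulr1.
  by exists t; apply: quat_inj; rewrite he ct st -hb -surjective_pairing.
Qed.

End Circle.

(** * Maximal tori of SU(2)^r and the subgroups G_I *)

Section MaximalTori.
Context (R : realType) (r : nat).
Implicit Types (T : set (SU2pow R r)) (I : {set 'I_r}) (n : 'I_r -> 'rV[R]_3).

(** For empty [I] this is a product of circles, the general form of a maximal torus; for other [I]
    it is an explicit description of G_I. *)
Definition axis_fixer n I : set (SU2pow R r) :=
  [set g | forall j, j \notin I -> rot (g j) (n j) = n j].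

Lemma axis_fixer_subgroup n I : is_subgroup (axis_fixer n I).
Proof.
split=> [j _|g h hg hh j jI|g hg j jI].
- by rewrite ffunE rot1.
- by rewrite ffunE rotM hh // hg.
- by rewrite ffunE -{1}(hg j jI) -rotM mulVg rot1.
Qed.

Lemma SU2pow_continuous (Z : topologicalType) (F : Z -> SU2pow R r) :
  (forall j, continuous (fun z => F z j)) -> continuous F.
Proof. exact: ffun_continuous. Qed.

Lemma SU2pow_coord_continuous j : continuous (fun g : SU2pow R r => g j).
Proof. exact: ffun_coord_continuous. Qed.

Lemma SU2pow_rot_continuous j v : continuous (fun g : SU2pow R r => rot (g j) v).
Proof.
exact: (comp_continuous (@SU2pow_coord_continuous j) (@rot_continuous R v)).
Qed.

Lemma SU2pow_compact : compact [set: SU2pow R r].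
Proof. by apply: ffun_compact; exact: SU2_compact. Qed.

Lemma axis_fixer_torus n : (forall j, S2 (n j)) ->
  is_torus (axis_fixer n finset.set0).
Proof.
move=> hn; split; first exact: axis_fixer_subgroup.
- apply: (subclosed_compact _ SU2pow_compact) => //.
  have -> : axis_fixer n finset.set0 =
      \bigcap_(j in [set: 'I_r]) [set g | rot (g j) (n j) = n j].
    apply/seteqP; split=> g hg j.
      by move=> _; apply: hg; rewrite finset.in_set0.
    by move=> _; exact: hg.
  apply: closed_bigI => j _.
  apply: (@closed_comp _ _ (fun g : SU2pow R r => rot (g j) (n j)) [set n j]).
    by move=> g _; exact: SU2pow_rot_continuous.
  exact: accessible_closed_set1 (hausdorff_accessible (@norm_hausdorff _ _)) _.
- have /choice[e he] : forall j, exists e : R -> SU2 R,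
      [/\ continuous e, e 0 = 1%g, forall t, rot (e t) (n j) = n j
        & forall U, rot U (n j) = n j -> exists t, e t = U].
    by move=> j; exact: circle_param.
  (* The group is a union of continuous curves through the identity, one for each vector [th] of
     angles. *)
  pose path (th : 'I_r -> R) (s : R) : SU2pow R r := [ffun j => e j (s * th j)].
  have -> : axis_fixer n finset.set0 =
      \bigcup_(th in [set: 'I_r -> R]) (path th @` setT).
    apply/seteqP; split=> [g hg|_ [th _ [s _ <-]] j _]; last first.
      by rewrite ffunE; case: (he j).
    have /choice[th hth] : forall j, exists t, e j t = g j.
      by move=> j; case: (he j) => _ _ _; apply; apply: hg; rewrite finset.in_set0.
    exists th => //; exists 1 => //; apply/ffunP => j.
    by rewrite ffunE mul1r hth.
  apply: bigcup_connected.
    exists 1%g => th _; exists 0 => //; apply/ffunP => j.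
    by rewrite !ffunE mul0r; case: (he j).
  move=> th _; apply: connected_continuous_connected.
    by apply/connected_intervalP => x y _ _ z.
  apply: continuous_subspaceT; apply: SU2pow_continuous => j.
  have -> : (fun s => path th s j) = (fun s => e j (s * th j)).
    by apply/funext => s; rewrite ffunE.
  have [ce _ _ _] := he j; have cm : continuous (fun s : R => s * th j).
    by move=> s; apply: cvgMl; exact: cvg_id.
  exact: (comp_continuous cm ce).
- move=> g h hg hh; apply/ffunP => j; rewrite !ffunE.
  by apply: (rot_fix_comm (hn j)); [apply: hg|apply: hh]; rewrite finset.in_set0.
Qed.

(** If some element of [T] has noncentral [j]-th factor, the axis of that factor is fixed by all of
    [T], because [T] is abelian. This puts [T] inside a torus [axis_fixer n finset.set0], and
    maximality gives equality. *)
Lemma maximal_torusE T : maximal_torus T ->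
  exists n, (forall j, S2 (n j)) /\ T = axis_fixer n finset.set0.
Proof.
move=> [[_ _ _ abT] maxT].
have /choice[n hn] : forall j, exists v : 'rV[R]_3,
    S2 v /\ forall g, T g -> rot (g j) v = v.
  move=> j; have [[g [Tg gj]]|all0] :=
      pselect (exists g, T g /\ (quat (g j)).2 != 0); last first.
    (* All [j]-th factors are central, so any unit vector is fixed. *)
    exists (vec3 1 0 0); split=> [|g Tg]; first by rewrite S2E !mxE /=; ring.
    apply/rot_fixP; first by rewrite S2E !mxE /=; ring.
    exists 0; rewrite scale0r; apply: contrapT => /eqP g0.
    by apply: all0; exists g.
  set u := (quat (g j)).2 in gj.
  pose k := u 0 0 ^+ 2 + u 0 1 ^+ 2 + u 0 2 ^+ 2.
  have k0 : k != 0.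
    apply: contra_neq gj => k0; have [e0 e1 e2] := sqr_sum_eq0 k0.
    by apply: vec3P; rewrite [RHS]mxE.
  have s0 : Num.sqrt k != 0.
    by rewrite gt_eqF // sqrtr_gt0 lt_neqAle eq_sym k0 !addr_ge0 ?sqr_ge0.
  exists ((Num.sqrt k)^-1 *: u); split; first exact: S2_normalize.
  move=> h Th; apply: (@comm_rot_fix _ _ (g j) _ (Num.sqrt k)) => //.
  - exact: S2_normalize.
  - by rewrite scalerA divff // scale1r.
  - by have /ffunP/(_ j) := abT _ _ Th Tg; rewrite !ffunE.
exists n; split=> [j|]; first by case: (hn j).
apply/esym/maxT; first by apply: axis_fixer_torus => j; case: (hn j).
by move=> g Tg j _; case: (hn j) => _; exact.
Qed.

(** One inclusion holds because the right-hand side is a subgroup containing the generators; for the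
    other, the factors indexed by [I] are split off one at a time. *)
Lemma GI_axis_fixer n I : GI (axis_fixer n finset.set0) I = axis_fixer n I.
Proof.
apply/seteqP; split=> [g|g hg].
  apply; split; first exact: axis_fixer_subgroup.
  move=> h [hh j _|[i /= iI hh] j jI]; first by apply: hh; rewrite finset.in_set0.
  by rewrite hh ?rot1 //; apply: contraNneq jI => ->.
have [_ GM _] := GI_subgroup (axis_fixer n finset.set0) I.
suff H (s : seq 'I_r) : forall h : SU2pow R r, {subset s <= I} ->
    (forall j, j \notin s -> rot (h j) (n j) = n j) ->
    GI (axis_fixer n finset.set0) I h.
  apply: (H (enum I)) => [j|j]; rewrite mem_enum //; exact: hg.
elim: s => [|i s IH] h sI hh.
  by move=> B [_ AB]; apply: AB; left => j _; exact: hh.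
(* [h1] lies in the [i]-th root subgroup and [h2] falls under the induction hypothesis. *)
pose h1 : SU2pow R r := [ffun j => if j == i then h j else 1%g].
pose h2 : SU2pow R r := [ffun j => if j == i then 1%g else h j].
have -> : h = (h1 * h2)%g.
  by apply/ffunP => j; rewrite !ffunE; case: eqP; rewrite ?mulg1 ?mul1g.
apply: GM.
  move=> B [_ AB]; apply: AB; right; exists i.
    by apply: sI; rewrite mem_head.
  by move=> j ji; rewrite ffunE (negPf ji).
apply: IH => [j js|j js]; first by apply: sI; rewrite inE js orbT.
rewrite ffunE; case: eqVneq => [_|ji]; first exact: rot1.
by apply: hh; rewrite inE negb_or ji.
Qed.

Lemma coset_piE n I (g h : SU2pow R r) :
  coset_pi (axis_fixer n finset.set0) I g = coset_pi (axis_fixer n finset.set0) I h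
  <-> forall j, j \notin I -> rot (g j) (n j) = rot (h j) (n j).
Proof.
rewrite -coset_piP GI_axis_fixer; split=> gh j jI.
  have := gh j jI; rewrite !ffunE rotM => /(congr1 (rot (g j))).
  by rewrite -rotM mulgV rot1.
by rewrite !ffunE rotM -gh // -rotM mulVg rot1.
Qed.

End MaximalTori.

(** * The comparison map *)

Section CosetDirections.
Context (R : realType) (r : nat) (n : 'I_r -> 'rV[R]_3).
Context (hn : forall j, S2 (n j)).
Local Notation T := (axis_fixer n finset.set0).

(** For [j] in [I] the coset does not determine a direction; the default 0 is harmless, since
    [height_bot] makes the scaling factor vanish there. *)
Definition dir (I : {set 'I_r}) (x : coset_space T I) (j : 'I_r) : 'rV[R]_3 :=
  if j \in I then 0 else rot (coset_repr x j) (n j).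

Lemma dir_pi I g j :
  dir (coset_pi T I g) j = if j \in I then 0 else rot (g j) (n j).
Proof.
rewrite /dir; case: ifPn => // jI.
by apply: (coset_piE n I _ _).1 => //; exact: coset_reprK.
Qed.

Lemma dir_continuous I j : continuous (fun x : coset_space T I => dir x j).
Proof.
apply/quotient_continuous.
have -> : (fun x : coset_space T I => dir x j) \o
    \pi_(quotient_topology {eq_quot coset_equiv T I})%qT =
    fun g => if j \in I then 0 else rot (g j) (n j).
  by apply/funext => g; exact: dir_pi.
case: (j \in I); first exact: cst_continuous.
exact: SU2pow_rot_continuous.
Qed.

Lemma dir_proj (I J : {set 'I_r}) (x : coset_space T I) j : I \subset J ->
  dir (coset_proj J x) j = if j \in J then 0 else dir x j.
Proof.
move=> IJ; rewrite -(coset_reprK x) coset_proj_pi // !dir_pi.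
case: ifPn => // jJ; case: ifPn => // /(fintype.subsetP IJ).
by rewrite (negPf jJ).
Qed.

Lemma dir_S2 I (x : coset_space T I) j : j \notin I -> S2 (dir x j).
Proof. by move=> jI; rewrite /dir (negPf jI); exact: rot_S2. Qed.

End CosetDirections.

(** * Radii of the coordinates of the image point *)

Section Heights.
Context (R : realType) (r : nat) (K : scomplex r).
Local Notation chain m := (chain (@face_le r K) m).

Definition height m (c : chain m) (t : 'rV[R]_m.+1) (j : 'I_r) : R :=
  \sum_(a | j \notin \val (c a)) t 0 a.

Lemma chain_subset m (c : chain m) (a b : 'I_m.+1) : (a <= b)%N ->
  {subset \val (c a) <= \val (c b)}.
Proof. by move=> ab; apply/fintype.subsetP; exact: (chain_le c). Qed.

Lemma height_ge0 m (c : chain m) (t : simplex R m) j : 0 <= height c (\val t) j.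
Proof. by have [t0 _] := set_mem (valP t); apply: sumr_ge0. Qed.

Lemma height_le1 m (c : chain m) (t : simplex R m) j : height c (\val t) j <= 1.
Proof.
have [t0 <-] := set_mem (valP t).
by rewrite [leRHS](bigID (fun a => j \notin \val (c a))) /= lerDl sumr_ge0.
Qed.

Lemma height_top m (c : chain m) (t : simplex R m) j :
  j \notin \val (c ord_max) -> height c (\val t) j = 1.
Proof.
move=> jc; have [_ <-] := set_mem (valP t); apply: eq_bigl => a.
by apply: contraNN jc; apply: chain_subset; rewrite leq_ord.
Qed.

Lemma height_bot m (c : chain m) (t : 'rV[R]_m.+1) j :
  j \in \val (c ord0) -> height c t j = 0.
Proof.
move=> jc; apply: big_pred0 => a; apply/negbTE; rewrite negbK.
exact: chain_subset jc.
Qed.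

Lemma height_pull m m' (th : 'I_m.+1 -> 'I_m'.+1) (hth : monotone th)
    (c : chain m') (t : 'rV[R]_m.+1) j :
  height c (push_coord th t) j = height (chain_pull hth c) t j.
Proof.
rewrite /height [RHS](partition_big th (fun b => j \notin \val (c b))) //=.
apply: eq_bigr => b jb; rewrite mxE; apply: eq_bigl => a.
by case: eqP => [->|]; rewrite ?andbF // jb.
Qed.

Lemma height_continuous m (c : chain m) j :
  continuous (fun t : 'rV[R]_m.+1 => height c t j).
Proof.
by apply: sum_continuous => a _; exact: mx_coord_continuous.
Qed.

End Heights.

Section Comparison.
Context (R : realType) (r : nat) (n : 'I_r -> 'rV[R]_3).
Context (hn : forall j, S2 (n j)).
Local Notation T := (axis_fixer n finset.set0).

Section OneComplex.
Context (K : scomplex r).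
Local Notation D := (coset_diagram T K).
Local Notation chain m := (chain (@face_le r K) m).

Definition point_of (a : bk_total R D) : {ffun 'I_r -> 'rV[R]_3} :=
  let: existT (existT m c) (x, t) := a in
  [ffun j => height c (\val t) j *: dir (n := n) x j].

Lemma point_of_polyprod a : point_of a \in polyprod_set K.
Proof.
case: a => [[m c] [x t]]; apply/mem_set.
have h01 j : 0 <= height c (\val t) j <= 1 by rewrite height_ge0 height_le1.
(* The top vertex of the chain is a suitable face: outside it all heights are 1. *)
exists (\val (c ord_max)); first exact: valP (c ord_max).
split=> j jc; rewrite ffunE.
  have -> : D3 (height c (\val t) j *: dir (n := n) x j) =
      (\sum_i (height c (\val t) j *: dir (n := n) x j) 0 i ^+ 2 <= 1) by [].
  under eq_bigr do rewrite mxE exprMn.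
  rewrite -mulr_sumr.
  have /andP[h0 h1] := h01 j.
  have [jc0|jc0] := boolP (j \in \val (c ord0)).
    by rewrite height_bot // expr0n mul0r.
  have -> : \sum_i dir (n := n) x j 0 i ^+ 2 = 1 by exact: (dir_S2 hn x jc0).
  by rewrite mulr1 expr_le1.
rewrite height_top // scale1r; apply: dir_S2 => //.
by apply: contraNN jc; apply: (chain_subset (a := ord0)); exact: leq0n.
Qed.

(** Heights agree by [height_pull]. Directions can differ only at indices in the bottom vertex of
    the pulled chain, where the height is 0. *)
Lemma point_of_glue a b : bk_glue a b -> point_of a = point_of b.
Proof.
case=> m m' th hth c x t; apply/ffunP => j; rewrite !ffunE height_pull.
rewrite dir_proj; last first.
  exact: (chain_le0 c (th ord0)).
by case: ifPn => // jc; rewrite height_bot ?scale0r.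
Qed.

Definition comparison (q : hocolim R D) : polyprod R K :=
  exist (fun y => y \in polyprod_set K) _ (point_of_polyprod (hocolim_repr q)).

Lemma comparison_pi a :
  \val (comparison (hocolim_pi a) : polyprod_set K) = point_of a.
Proof.
rewrite /=; set b := hocolim_repr _.
have /hocolim_piP : hocolim_pi b = hocolim_pi a by exact: hocolim_reprK.
by elim=> {a b} [a b /point_of_glue|a|a b _ ->|a b c _ -> _ ->].
Qed.

Lemma comparison_continuous : continuous comparison.
Proof.
apply/quotient_continuous; apply: set_type_continuous.
pose F (s : {m : nat & chain m})
    (z : (D (projT2 s ord0) * simplex R (projT1 s))%type) :
    {ffun 'I_r -> 'rV[R]_3} :=
  [ffun j => height (projT2 s) (\val z.2) j *: dir (n := n) z.1 j].
have -> : (fun z => set_val ((comparison \o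
    \pi_(quotient_topology {eq_quot bk_equiv R D})%qT) z)) = sigT_fun F.
  by apply/funext => -[[m c] [x t]]; exact: comparison_pi.
apply: sigT_continuous => -[m c]; apply: ffun_continuous => j.
have -> : (fun z => F (existT _ m c) z j) =
    (fun z : (D (c ord0) * simplex R m)%type =>
      height c (\val z.2) j *: dir (n := n) z.1 j).
  by apply/funext => z; rewrite ffunE.
suff [ch cd] : continuous (fun z : (D (c ord0) * simplex R m)%type =>
    height c (\val z.2) j) /\
  continuous (fun z : (D (c ord0) * simplex R m)%type => dir (n := n) z.1 j).
  by move=> z; exact: (cvgZ (ch z) (cd z)).
split.
  apply: (comp_continuous (f := fun z : (D (c ord0) * simplex R m)%type => \val z.2)
    (g := fun t => height c t j)); last exact: height_continuous.
  apply: (comp_continuous (f := snd) (g := fun t : simplex R m => \val t)).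
    by move=> w; exact: cvg_snd.
  exact: initial_continuous.
apply: (comp_continuous (f := fst)
  (g := fun x : coset_space T (\val (c ord0)) => dir (n := n) x j)).
  by move=> w; exact: cvg_fst.
exact: dir_continuous.
Qed.

End OneComplex.

Lemma comparison_natural (K L : scomplex r) (KL : faces K \subset faces L)
    (q : XK T K) :
  comparison (XK_incl KL q) = polyprod_incl KL (comparison q).
Proof.
apply: val_inj; rewrite -(hocolim_reprK q).
case: (hocolim_repr q) => -[m c] [x t].
by rewrite (XK_incl_pi KL x t) comparison_pi [RHS]comparison_pi.
Qed.

End Comparison.

(** * Normal forms in the homotopy colimit *)

Section Levels.
Context (R : realType) (r : nat).
Implicit Types (s : 'I_r -> R) (i j : 'I_r).

Definition rank_le s j := #|[set i | s i <= s j]%SET|.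

(* If some sublevel set [{j | s j < l}], [0 < l <= 1], has [b] elements, then it
   is [level_set s b].  Vertices of height 0 are put in every [level_set], because
   the direction [v_j] is not determined by the image point when [s j = 0]. *)
Definition level_set s (b : nat) : {set 'I_r} :=
  [set j | (s j < 1) && ((s j == 0) || (rank_le s j <= b)%N)]%SET.

(* The length of the set of the [l] in [(0, 1]] with at most [b] elements in
   [{j | s j < l}] *)
Definition level_sum s (b : nat) : R :=
  \big[Num.min/1]_(j | (b < rank_le s j)%N) s j.

(** For nonnegative [s], the length of the set of the [l] in [(0, 1]] with exactly [b] elements in
    [{j | s j < l}]. *)
Definition level_weight s (b : nat) : R :=
  level_sum s b - (if b is b'.+1 then level_sum s b' else 0).

Lemma rank_le_gt0 s j : (0 < rank_le s j)%N.
Proof. by apply/card_gt0P; exists j; rewrite inE. Qed.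

Lemma rank_le_max s j : (rank_le s j <= r)%N.
Proof. by rewrite -[leqRHS](card_ord r) max_card. Qed.

Lemma rank_leP s i j : (rank_le s j <= rank_le s i)%N -> s j <= s i.
Proof.
apply: contraTT; rewrite -ltNge -ltnNge => ij; apply: proper_card.
apply/properP; split.
  by apply/fintype.subsetP => k; rewrite !inE => /le_trans; apply; exact: ltW.
by exists j; rewrite !inE // -ltNge.
Qed.

Lemma level_setS s b b' : (b <= b')%N -> level_set s b \subset level_set s b'.
Proof.
move=> bb'; apply/fintype.subsetP => j; rewrite !inE => /andP[-> /orP[->//|jb]] /=.
by rewrite (leq_trans jb bb') orbT.
Qed.

Lemma level_sum_le1 s b : level_sum s b <= 1.
Proof. exact: bigmin_le_id. Qed.

Lemma level_sum_top s : level_sum s r = 1.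
Proof. by apply: big_pred0 => j; rewrite ltnNge rank_le_max. Qed.

Lemma level_sum_mono s b b' : (b <= b')%N -> level_sum s b <= level_sum s b'.
Proof.
move=> bb'; apply/bigmin_geP; split=> [|j jb']; first exact: level_sum_le1.
by apply: bigmin_le_cond; exact: leq_ltn_trans jb'.
Qed.

Lemma level_sum_ge0 s b : (forall j, 0 <= s j) -> 0 <= level_sum s b.
Proof. by move=> s0; apply/bigmin_geP. Qed.

Lemma level_weight_ge0 s b : (forall j, 0 <= s j) -> 0 <= level_weight s b.
Proof.
move=> s0; rewrite /level_weight; case: b => [|b].
  by rewrite subr0 level_sum_ge0.
by rewrite subr_ge0 level_sum_mono.
Qed.

Lemma sum_level_weight s b : \sum_(a < b.+1) level_weight s a = level_sum s b.
Proof.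
elim: b => [|b IH].
  by rewrite big_ord_recr big_ord0 /= add0r /level_weight subr0.
by rewrite big_ord_recr IH /level_weight /=; ring.
Qed.

(** The index [j] itself takes part in the minimum, and every other index taking part has rank at
    least that of [j]. *)
Lemma level_sum_rank s j b : s j <= 1 -> rank_le s j = b.+1 -> level_sum s b = s j.
Proof.
move=> s1 jb; apply/eqP; rewrite eq_le; apply/andP; split.
  by apply: bigmin_le_cond; rewrite jb.
by apply/bigmin_geP; split=> // i bi; apply: rank_leP; rewrite jb.
Qed.

(** The level sets with these weights have the prescribed heights. A [j] of height 1 lies in no
    level set and one of height 0 in all of them; otherwise [j] is missing exactly for [b] below its
    rank, and the sum telescopes. *)
Lemma level_height s j : 0 <= s j <= 1 ->
  \sum_(b < r.+1 | j \notin level_set s b) level_weight s b = s j.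
Proof.
move=> /andP[s0 s1].
have [sj1|sj1] := eqVneq (s j) 1.
  rewrite sj1 -[RHS](level_sum_top s) -sum_level_weight.
  by apply: eq_bigl => b; rewrite inE sj1 ltxx.
have {}sj1 : s j < 1 by rewrite lt_neqAle sj1.
have [sj0|sj0] := eqVneq (s j) 0.
  rewrite sj0; apply: big_pred0 => b; rewrite inE sj0 eqxx ltr01.
  by [].
case jb: (rank_le s j) (rank_le_gt0 s j) (rank_le_max s j) => [//|b] _ br.
rewrite -[RHS](level_sum_rank s1 jb) -sum_level_weight.
rewrite (big_ord_widen_cond r.+1 predT (level_weight s)); last exact: leqW.
apply: eq_bigl => a; rewrite inE sj1 (negPf sj0) /= jb -ltnNge.
by [].
Qed.

Context (K : scomplex r).
Local Notation chain m := (chain (@face_le r K) m).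

Lemma level_face s : [set j | s j < 1]%SET \in faces K ->
  forall b, level_set s b \in faces K.
Proof.
move=> sK b; apply: faces_sub sK; apply/fintype.subsetP => j.
by rewrite !inE => /andP[].
Qed.

Definition level_chain_face s (hs : [set j | s j < 1]%SET \in faces K)
    (b : 'I_r.+1) : face K :=
  exist (fun I : {set 'I_r} => I \in faces K) (level_set s b) (level_face hs b).

(** A single chain of fixed length determined by the heights; repeated vertices are allowed. *)
Definition level_chain s (hs : [set j | s j < 1]%SET \in faces K) : chain r :=
  @Chain (face K) (@face_le r K) r (level_chain_face hs)
    (fun a a' aa' => level_setS s aa').

(** * Recovering a chain with positive weights from its heights *)

Section PositiveWeights.
Context (m : nat) (c : chain m) (t : simplex R m).
Context (t_gt0 : forall a, 0 < \val t 0 a).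
Let s := height c (\val t).

(** Every vertex missing [i] also misses [j], and the vertex [a], of positive weight, misses only
    [j]. *)
Lemma height_lt a i j : i \in \val (c a) -> j \notin \val (c a) -> s i < s j.
Proof.
move=> ia ja; rewrite /s /height.
rewrite (bigID (fun b : 'I__ => i \notin \val (c b))
  (fun b => j \notin \val (c b))) /=.
have -> : \sum_(b | (j \notin \val (c b)) && (i \notin \val (c b))) \val t 0 b =
    \sum_(b | i \notin \val (c b)) \val t 0 b.
  apply: eq_bigl => b; rewrite andbC; case: (boolP (i \notin _)) => //= ib.
  apply: contraNN ja => jb; apply: chain_subset jb.
  rewrite leqNgt; apply: contraNN ib => ab; apply: chain_subset ia; exact: ltnW.
rewrite ltrDl (bigD1 a) /= ?ja ?ia // ltr_pwDl // sumr_ge0 // => b _.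
exact: ltW.
Qed.

(** By [height_lt], all heights in [c a] are strictly below those outside, so [c a] is cut out by
    its cardinality alone. *)
Lemma rank_le_mem a j : j \in \val (c a) = (rank_le s j <= #|\val (c a)|)%N.
Proof.
have [ja|ja] := boolP (j \in _).
  apply/esym/subset_leq_card/fintype.subsetP => i.
  rewrite inE; apply: contraTT => ia; rewrite -ltNge.
  exact: height_lt ja ia.
apply/esym/negbTE; rewrite -ltnNge.
have := cardsU1 j (\val (c a)); rewrite ja add1n => <-.
apply: subset_leq_card; apply/fintype.subsetP => i.
rewrite !inE => /orP[/eqP->|ia]; first exact: lexx.
by apply: ltW; exact: height_lt ia ja.
Qed.

Lemma positive_vertex a : \val (c a) = level_set s #|\val (c a)|.
Proof.
apply/setP => j; rewrite inE -rank_le_mem; apply/idP/idP => [ja|].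
  (* An index in [c a] misses the positive weight [t a], so its height is below 1; conversely, an
     index outside has positive height. *)
  rewrite ja orbT andbT.
  have [_ <-] := set_mem (valP t).
  rewrite [ltRHS](bigID (fun b => j \notin \val (c b))) /= ltrDl.
  by rewrite (bigD1 a) /= ?negbK // ltr_pwDl // sumr_ge0 // => b _; exact: ltW.
case/andP => _ /orP[|//]; apply: contraTT => ja.
rewrite gt_eqF // /s /height (bigD1 a) //= ltr_pwDl // sumr_ge0 // => b _.
exact: ltW.
Qed.

Lemma positive_level_sum b :
  \sum_(a | (#|\val (c a)| <= b)%N) \val t 0 a = level_sum s b.
Proof.
have t0 a : 0 <= \val t 0 a by exact: ltW.
have sub (P Q : pred 'I_m.+1) : (forall a, P a -> Q a) ->
    \sum_(a | P a) \val t 0 a <= \sum_(a | Q a) \val t 0 a.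
  move=> PQ; rewrite [leRHS](bigID P) /= (eq_bigl P) ?lerDl ?sumr_ge0 // => a.
  by rewrite andb_idl //; exact: PQ.
have [_ t1] := set_mem (valP t).
apply/eqP; rewrite eq_le; apply/andP; split.
  apply/bigmin_geP; split=> [|j jb]; first by rewrite -t1; exact: sub.
  by apply: sub => a ab; rewrite rank_le_mem -ltnNge (leq_ltn_trans ab).
have [/forallP all_b|] := boolP [forall a, (#|\val (c a)| <= b)%N].
  by rewrite (eq_bigl predT) // t1 level_sum_le1.
rewrite negb_forall => /existsP[a1]; rewrite -ltnNge => ba1.
(* Take a smallest vertex with more than [b] elements and in it an index [j] of greatest height: [j]
   has rank above [b], and each vertex missing [j] has at most [b] elements. *)
case: (@arg_minnP _ a1 (fun a => b < #|\val (c a)|)%N (fun a => #|\val (c a)|) ba1).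
move=> a ba amin.
have /card_gt0P[j0 j0a] : (0 < #|\val (c a)|)%N by exact: leq_ltn_trans ba.
case: (@arg_maxP _ _ _ j0 (fun j => j \in \val (c a)) s j0a) => j ja jmax.
apply: (@le_trans _ _ (s j)).
  apply: bigmin_le_cond; apply: leq_trans ba _.
  by apply: subset_leq_card; apply/fintype.subsetP => i ia; rewrite inE; exact: jmax.
apply: sub => a' ja'; rewrite leqNgt; apply: contraNN ja' => /amin.
have [aa' _|/ltnW a'a] := leqP a a'; first exact: chain_subset ja.
by move=> le; have /eqP-> : \val (c a') == \val (c a);
  rewrite // eqEcard le andbT; exact: (chain_le c).
Qed.

Lemma positive_level_weight b :
  \sum_(a | #|\val (c a)| == b) \val t 0 a = level_weight s b.
Proof.
rewrite /level_weight; case: b => [|b]; rewrite -!positive_level_sum.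
  by rewrite subr0; apply: eq_bigl => a; rewrite leqn0.
rewrite [X in _ = X - _](bigID (fun a => #|\val (c a)| <= b)%N) /=.
have -> : \sum_(a | (#|\val (c a)| <= b.+1)%N && (#|\val (c a)| <= b)%N) \val t 0 a =
    \sum_(a | (#|\val (c a)| <= b)%N) \val t 0 a.
  by apply: eq_bigl => a; rewrite andb_idl // => /leq_trans; apply.
rewrite addrAC subrr add0r; apply: eq_bigl => a.
by rewrite -ltnNge eqn_leq.
Qed.

End PositiveWeights.

End Levels.

Lemma simplex_compact (R : realType) m : compact [set: simplex R m].
Proof.
apply: compact_set_type.
apply: (@subclosed_compact _ _
  [set v : 'rV[R]_m.+1 | forall i, `[0, 1]%classic (v 0 i)]).
- have -> : simplex R m = \bigcap_(a in [set: 'I_m.+1]) [set t | 0 <= t 0 a] `&`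
      [set t | \sum_a t 0 a = 1].
    by apply/seteqP; split=> t /= [t0 t1]; split=> // a; [move=> _|]; exact: t0.
  apply: closedI.
    apply: closed_bigI => a _.
    apply: (@closed_comp _ _ (fun t : 'rV[R]_m.+1 => t 0 a) [set x | 0 <= x]).
      by move=> t _; exact: mx_coord_continuous.
    exact: closed_ge.
  apply: (@closed_comp _ _ (fun t : 'rV[R]_m.+1 => \sum_a t 0 a) [set x | x = 1]).
    have cs : continuous (fun t : 'rV[R]_m.+1 => \sum_a t 0 a).
      by apply: sum_continuous => a _; exact: mx_coord_continuous.
    by move=> t _; exact: cs.
  exact: closed_eq.
- apply: (@rV_compact R m.+1 (fun=> `[0, 1]%classic)) => _.
  exact: segment_compact.
- move=> t [t0 t1] i; rewrite /= in_itv /= t0 -t1 (bigD1 i) //= lerDl.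
  by apply: sumr_ge0 => a _; exact: t0.
Qed.

Section NormalForm.
Context (R : realType) (r : nat) (n : 'I_r -> 'rV[R]_3).
Context (hn : forall j, S2 (n j)).
Context (K : scomplex r).
Local Notation T := (axis_fixer n finset.set0).
Local Notation D := (coset_diagram T K).
Local Notation chain m := (chain (@face_le r K) m).

(** A group element is used in place of a coset so that [g] stays the same when the chain is pulled
    back. *)
Definition hpoint m (c : chain m) (g : SU2pow R r) (t : simplex R m) :
    hocolim R D :=
  hocolim_pi (@bk_point R _ _ D m c (coset_pi T (\val (c ord0)) g) t).

Lemma hpoint_surj q : exists m (c : chain m) g t, q = hpoint c g t.
Proof.
rewrite -(hocolim_reprK q); case: (hocolim_repr q) => -[m c] [x t].
exists m, c, (coset_repr x), t; rewrite /hpoint.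
by rewrite (coset_reprK (x : coset_space T (\val (c ord0)))).
Qed.

Lemma hpoint_pull m m' (th : 'I_m.+1 -> 'I_m'.+1) (hth : monotone th)
    (c : chain m') g (t : simplex R m) :
  hpoint c g (simplex_push th t) = hpoint (chain_pull hth c) g t.
Proof.
apply/hocolim_piP; apply: rst_step.
have := @BkGlue R _ _ D m m' th hth c (coset_pi T (\val (c ord0)) g) t.
rewrite [dmap _ _ _](@coset_proj_pi _ _ T _ _ g (chain_le0 c (th ord0))); exact.
Qed.

Lemma hpoint_chain m (c c' : chain m) g t :
  (forall a, \val (c a) = \val (c' a)) -> hpoint c g t = hpoint c' g t.
Proof.
move=> cc'; suff -> : c = c' by [].
case: c c' cc' => [v hv] [v' hv'] /= vv'.
have {}vv' : v = v' by apply/funext => a; exact/val_inj/vv'.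
by case: _ / vv' hv' => hv'; congr Chain; exact: Prop_irrelevance.
Qed.

Lemma hpoint_coset m (c : chain m) (g g' : SU2pow R r) t :
  (forall j, j \notin \val (c ord0) -> rot (g j) (n j) = rot (g' j) (n j)) ->
  hpoint c g t = hpoint c g' t.
Proof. by move=> /coset_piE gg'; rewrite /hpoint gg'. Qed.

Lemma comparison_hpoint m (c : chain m) g t j :
  \val (comparison hn (hpoint c g t) : polyprod_set K) j =
  height c (\val t) j *: (if j \in \val (c ord0) then 0 else rot (g j) (n j)).
Proof. by rewrite comparison_pi ffunE dir_pi. Qed.

Lemma lift_monotone m (a : 'I_m.+2) : monotone (lift a : 'I_m.+1 -> 'I_m.+2).
Proof. by move=> b b' bb' /=; rewrite leq_bump2. Qed.

(** Vertices of weight 0 are deleted one by one; each deletion is the gluing along a face map. *)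
Lemma hpoint_positive m (c : chain m) g (t : simplex R m) :
  exists m' (c' : chain m') (t' : simplex R m'),
    hpoint c g t = hpoint c' g t' /\ forall a, 0 < \val t' 0 a.
Proof.
elim: m c t => [|m IH] c t; have [t0 t1] := set_mem (valP t).
  exists 0%N, c, t; split=> // a; move: t1; rewrite big_ord1 (ord1 a) => ->.
  exact: ltr01.
have [/forallP tpos|] := boolP [forall a, 0 < \val t 0 a].
  by exists m.+1, c, t.
rewrite negb_forall => /existsP[a]; rewrite lt_neqAle t0 andbT negbK eq_sym.
move=> /eqP ta0.
pose u : 'rV[R]_m.+1 := \row_i \val t 0 (lift a i).
have uS : u \in simplex R m.
  apply/mem_set; split=> [i|]; first by rewrite mxE.
  under eq_bigr do rewrite mxE.
  by rewrite -t1 [RHS](bigD1_ord a) //= ta0 add0r.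
pose t' : simplex R m := exist (fun v => v \in simplex R m) u uS.
have tE : t = simplex_push (lift a) t'.
  apply: val_inj; apply/rowP => b; rewrite mxE.
  case: (unliftP a b) => [i ->|->].
    rewrite (big_pred1 i) ?mxE // => k.
    by apply/eqP/eqP => [/lift_inj|->].
  by rewrite ta0 big_pred0 // => k; rewrite eq_sym (negPf (neq_lift _ _)).
have [m' [c' [t'' [h hpos]]]] := IH (chain_pull (@lift_monotone m a) c) t'.
by exists m', c', t''; split=> //; rewrite tE (hpoint_pull (@lift_monotone m a)) h.
Qed.

(** By [positive_vertex], [c] is the pullback of the level chain along the map sending [a] to the
    cardinality of [c a]; the weights are pushed forward along it. *)
Lemma hpoint_level m (c : chain m) g (t : simplex R m) :
  (forall a, 0 < \val t 0 a) ->
  forall (s : 'I_r -> R) (hs : [set j | s j < 1]%SET \in faces K),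
  height c (\val t) = s ->
  exists u : simplex R r, hpoint c g t = hpoint (level_chain hs) g u /\
    forall b, \val u 0 b = level_weight s b.
Proof.
move=> tpos s hs sE.
have rP (a : 'I_m.+1) : (#|\val (c a)| < r.+1)%N.
  by rewrite ltnS -[leqRHS](card_ord r) max_card.
pose th (a : 'I_m.+1) : 'I_r.+1 := Ordinal (rP a).
have hth : monotone th by move=> a b ab; apply: subset_leq_card; exact: (chain_le c).
exists (simplex_push th t); split.
  rewrite (hpoint_pull hth); apply: hpoint_chain => a /=.
  by rewrite -sE; exact: positive_vertex.
by move=> b; rewrite mxE -sE -positive_level_weight.
Qed.

(** * Euclidean norms and bijectivity of the comparison map *)

Definition enorm (v : 'rV[R]_3) : R := Num.sqrt (\sum_i v 0 i ^+ 2).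

Lemma enormZ a v : 0 <= a -> S2 v -> enorm (a *: v) = a.
Proof.
move=> a0 hv; rewrite /enorm; under eq_bigr do rewrite mxE exprMn.
rewrite -mulr_sumr; have -> : \sum_i v 0 i ^+ 2 = 1 by exact: hv.
by rewrite mulr1 sqrtr_sqr ger0_norm.
Qed.

Lemma comparison_height m (c : chain m) g (t : simplex R m) :
  height c (\val t) =
  fun j => enorm (\val (comparison hn (hpoint c g t) : polyprod_set K) j).
Proof.
apply/funext => j; rewrite comparison_hpoint.
case: ifPn => [jc|jc]; last by rewrite enormZ ?height_ge0 //; exact: rot_S2.
rewrite height_bot // scale0r /enorm big1 ?sqrtr0 // => i _.
by rewrite mxE expr0n.
Qed.

Lemma polyprod_face (y : polyprod_set K) :
  [set j | enorm (\val y j) < 1]%SET \in faces K.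
Proof.
have [I IK [_ yS]] := set_mem (valP y); apply: faces_sub IK.
apply/fintype.subsetP => j; rewrite inE; apply: contraTT => /yS hj.
rewrite -leNgt /enorm; have -> : \sum_i \val y j 0 i ^+ 2 = 1 by exact: hj.
by rewrite sqrtr1.
Qed.

Lemma enorm_le1 (y : polyprod_set K) j : 0 <= enorm (\val y j) <= 1.
Proof.
rewrite sqrtr_ge0 /=; have [I IK [yD yS]] := set_mem (valP y).
rewrite -[leRHS]sqrtr1 ler_wsqrtr //.
have [/yD//|/yS hj] := boolP (j \in I).
by have -> : \sum_i \val y j 0 i ^+ 2 = 1 by exact: hj.
Qed.

Lemma height_level (y : polyprod_set K) (u : simplex R r) j :
  (forall b, \val u 0 b = level_weight (fun j => enorm (\val y j)) b) ->
  height (level_chain (polyprod_face y)) (\val u) j = enorm (\val y j).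
Proof.
move=> uE.
rewrite -[RHS](@level_height _ _ (fun j => enorm (\val y j))) ?enorm_le1 //.
by apply: eq_bigr => b _; rewrite uE.
Qed.

Lemma level_bottom (y : polyprod_set K) j :
  (j \in \val (level_chain (polyprod_face y) ord0)) = (enorm (\val y j) == 0).
Proof.
rewrite inE leqNgt rank_le_gt0 orbF andb_idl // => /eqP->.
exact: ltr01.
Qed.

(** Heights are the norms of the coordinates of [y], so chain and weights depend on [y] alone; only
    [g] remains free. *)
Lemma hpoint_normal (q : hocolim R D) (y : polyprod_set K) :
  comparison hn q = y -> exists g (u : simplex R r),
  q = hpoint (level_chain (polyprod_face y)) g u /\
  forall b, \val u 0 b = level_weight (fun j => enorm (\val y j)) b.
Proof.
have [m [c [g [t ->]]]] := hpoint_surj q.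
have [m' [c' [t' [-> tpos]]]] := hpoint_positive c g t => yE.
have sE : height c' (\val t') = fun j => enorm (\val y j).
  by rewrite (comparison_height c' g t') yE.
have [u [hu uE]] := hpoint_level g tpos (polyprod_face y) sE.
by exists g, u.
Qed.

Lemma comparison_inj : injective (comparison (K := K) hn).
Proof.
move=> p q; move qy : (comparison hn q) => y py.
have [g [u [pE uE]]] := hpoint_normal py.
have [h [v [qE vE]]] := hpoint_normal qy.
have uv : u = v by apply: val_inj; apply/rowP => b; rewrite uE vE.
have := etrans py (esym qy); rewrite pE qE -uv => pq.
apply: hpoint_coset => j jC.
have /(congr1 (fun y : polyprod_set K => \val y j)) := pq.
rewrite !comparison_hpoint (negPf jC) height_level //.
(* Outside the bottom vertex the height is nonzero and can be cancelled. *)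
by apply: scalerI; move: jC; rewrite level_bottom.
Qed.

Lemma comparison_surj (y : polyprod_set K) : exists q, comparison (K := K) hn q = y.
Proof.
pose s j := enorm (\val y j).
have s01 j : 0 <= s j <= 1 by exact: enorm_le1.
have s0 j : 0 <= s j by case/andP: (s01 j).
have uS : \row_b level_weight s b \in simplex R r.
  apply/mem_set; split=> [b|]; first by rewrite mxE level_weight_ge0.
  by under eq_bigr do rewrite mxE; rewrite sum_level_weight level_sum_top.
pose u : simplex R r := exist (fun v => v \in simplex R r) _ uS.
have uE b : \val u 0 b = level_weight s b by rewrite mxE.
(* [g j] turns [n j] to the direction of the [j]-th coordinate of [y]; it is arbitrary where that
   coordinate is 0. *)
have /choice[g hg] : forall j, exists U, s j != 0 -> s j *: rot U (n j) = \val y j.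
  move=> j; have [sj0|sj0] := eqVneq (s j) 0; first by exists 1%g.
  have yS : S2 ((s j)^-1 *: \val y j).
    have -> : S2 ((s j)^-1 *: \val y j) =
      (\sum_i ((s j)^-1 *: \val y j) 0 i ^+ 2 = 1) by [].
    under eq_bigr do rewrite mxE exprMn.
    rewrite -mulr_sumr exprVn sqr_sqrtr ?sumr_ge0 // => [|i _]; last exact: sqr_ge0.
    by rewrite mulVf // gt_eqF // -sqrtr_gt0 lt_neqAle eq_sym sj0 sqrtr_ge0.
  have [U UE] := rot_transitive (hn j) yS.
  by exists U => _; rewrite UE scalerA divff // scale1r.
exists (hpoint (level_chain (polyprod_face y)) (finfun g) u).
apply: val_inj; apply/ffunP => j; rewrite comparison_hpoint height_level //.
rewrite level_bottom ffunE; case: eqP => [sj0|/eqP sj0]; last exact: hg.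
rewrite scaler0; apply/esym/rowP => i; rewrite mxE; apply/eqP.
rewrite -sqrf_eq0; apply/eqP; move: sj0 => /eqP.
rewrite sqrtr_eq0 => sj0.
have : \sum_i \val y j 0 i ^+ 2 == 0.
  by rewrite eq_le sj0 sumr_ge0 // => k _; exact: sqr_ge0.
by rewrite psumr_eq0 => [/allP/(_ i)|k _];
  [rewrite mem_index_enum => /(_ isT)/eqP|exact: sqr_ge0].
Qed.

(** * Compactness and the equivalence *)

Lemma finite_chains m : finite_set [set: chain m].
Proof.
pose F (c : chain m) : {ffun 'I_m.+1 -> {set 'I_r}} := [ffun a => \val (c a)].
have -> : [set: chain m] = F @^-1` setT by [].
apply: finite_preimage; last exact: finite_finset.
move=> [v hv] [v' hv'] _ _ /ffunP FE.
have vv' : v = v'.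
  by apply/funext => a; apply: val_inj; have := FE a; rewrite !ffunE.
by case: _ / vv' hv' FE => hv' _; congr Chain; exact: Prop_irrelevance.
Qed.

(** Chains of all lengths enter the homotopy colimit, but by [hpoint_normal] the finitely many
    chains in [chain r] already cover it, each contributing the image of a compact product. *)
Lemma XK_compact : compact [set: hocolim R D].
Proof.
pose X (c : chain r) := (SU2pow R r * simplex R r)%type.
pose F : {c : chain r & X c} -> hocolim R D :=
  sigT_fun (fun (c : chain r) (z : X c) => hpoint c z.1 z.2).
have -> : [set: hocolim R D] = F @` setT.
  apply/seteqP; split=> // q _.
  have [g [u [-> _]]] := hpoint_normal (erefl (comparison hn q)).
  by exists (existT X (level_chain (polyprod_face (comparison hn q))) (g, u)).
apply: continuous_compact; last first.
  apply: sigT_compact; first exact: finite_chains.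
  move=> c; rewrite -setXTT; apply: compact_setX.
    exact: SU2pow_compact.
  exact: simplex_compact.
apply: continuous_subspaceT; apply: sigT_continuous => c.
pose B (s : {m : nat & chain m}) := (D (projT2 s ord0) * simplex R (projT1 s))%type.
pose G (z : X c) : B (existT _ r c) := (coset_pi T (\val (c ord0)) z.1, z.2).
have cG : continuous G.
  have c1 : continuous (fun z : X c => coset_pi T (\val (c ord0)) z.1).
    apply: (comp_continuous (f := fst) (g := coset_pi T (\val (c ord0)))).
      by move=> z; exact: cvg_fst.
    exact: pi_continuous.
  by move=> z; exact: (cvg_pair (c1 z) cvg_snd).
have cE := comp_continuous cG (@existT_continuous _ B (existT _ r c)).
exact: (comp_continuous cE (@pi_continuous _ _)).
Qed.

Lemma comparison_equivalence : homotopy_equivalence R (comparison (K := K) hn).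
Proof.
have /choice[g fK] := comparison_surj.
have gK : cancel (comparison (K := K) hn) g by move=> q; apply: comparison_inj.
have cf : continuous (comparison (K := K) hn) by exact: comparison_continuous.
have hY : hausdorff_space (polyprod R K).
  apply: (@hausdorff_inj _ _ (fun y : polyprod R K => \val (y : polyprod_set K))).
  - exact: initial_continuous.
  - exact: val_inj.
  - by apply: ffun_hausdorff; exact: norm_hausdorff.
have cg : continuous g := compact_hausdorff_inverse XK_compact hY cf gK fK.
(* Both composites are identities, so constant homotopies suffice. *)
have hid (X : topologicalType) (h : X -> X) : h =1 id -> homotopic R h id.
  move=> hE; exists fst; split=> [z|x t]; first exact: cvg_fst.
  by rewrite /= hE.
split=> //; exists g; split=> //; exact: hid.
Qed.

End NormalForm.

Theorem theorem8p1 (R : realType) (r : nat) (hr : (1 <= r)%N)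
    (T : set (SU2pow R r)) (hT : maximal_torus T) :
  exists f : forall K : scomplex r, XK T K -> polyprod R K,
    (forall K : scomplex r, homotopy_equivalence R (f K)) /\
    (forall (K L : scomplex r) (KL : faces K \subset faces L) (x : XK T K),
       f L (XK_incl KL x) = polyprod_incl KL (f K x)).
Proof.
(* The axes are chosen once, before the complex, which makes the maps for different complexes
   compatible. *)
have [n [hn ->]] := maximal_torusE hT.
exists (fun K => comparison (K := K) hn); split=> [K|K L KL x].
  exact: comparison_equivalence.
exact: comparison_natural.
Qed.
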